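(* Let $G$ be a finitely presented group. Then the following are equivalent: 1. some finite index subgroup of $G$ admits a surjective homomorphism onto a non-abelian free group; 2. there exists an infinite sequence $G_1 \geq G_2 \geq \dots$ of finite index subgroups of $G$, each normal in $G_1$, such that (i) $G_i/G_{i+1}$ is abelian for all $i \geq 1$; (ii) $\lim_{i \rightarrow \infty} \dfrac{\log [G_i : G_{i+1}]}{[G:G_i]} = \infty$; (iii) $\limsup_{i\to\infty} \dfrac{d(G_i/G_{i+1})}{[G:G_i]} > 0$.
   Context: For a finitely generated group $\Gamma$, $d(\Gamma)$ denotes its rank, i.e. the minimal number of elements in a generating set of $\Gamma$. The subgroup $G_1$ is not required to be normal in $G$. *)

(* Defs.v *)
From HB Require Import structures.
From mathcomp Require Import all_boot all_order all_algebra.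
From mathcomp Require Import finmap.
From mathcomp Require Import all_classical all_reals all_analysis.

Set Implicit Arguments.
Unset Strict Implicit.
Unset Printing Implicit Defensive.

Import Order.TTheory GRing.Theory Num.Theory.
Import numFieldNormedType.Exports.

Local Open Scope classical_set_scope.
Local Open Scope group_scope.

Section Generation.
Variable G : groupType.
Implicit Types (S : set G) (N : groupClosed G).

Definition is_abelian := forall x y : G, commute x y.

Definition is_normal (K : {pred G}) N :=
  {subset N <= K} /\ {in K & N, forall x y, y ^ x \in N}.

Definition generated_subgroup S : set G :=
  \bigcap_(H in [set H : groupClosed G | S `<=` [set` H]]) [set` H].

Definition normal_closure S : set G :=
  \bigcap_(N in [set N : groupClosed G |
             is_normal predT N /\ S `<=` [set` N]]) [set` N].

Definition generates (s : seq G) := generated_subgroup [set` s] = [set: G].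

(* Repetitions in s are harmless: undup s generates as much as s. *)
Definition is_rank (n : nat) :=
  (exists2 s : seq G, generates s & size s = n) /\
  (forall s : seq G, generates s -> n <= size s).

(* Junk value 0 when G is not finitely generated. *)
Definition group_rank : nat := xget 0 [set n | is_rank n].

Definition left_coset (x : G) N : set G := [set x * y | y in [set` N]].

Definition left_cosets (K : {pred G}) N : set (set G) :=
  [set left_coset x N | x in [set` K]].

Definition has_finite_index N := finite_set (left_cosets predT N).

(* Junk value 0 when there are infinitely many cosets. *)
Definition subgroup_index (K : {pred G}) N : nat :=
  #|` fset_set (left_cosets K N)|%fset.

End Generation.

Section Quotient.
Variables (G : groupType) (K N : groupClosed G).

Definition normalises (x : G) := forall y : G, (y ^ x \in N) = (y \in N).

(* The clause on normalises makes this a group for all K and N, so that no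
   proof of normality has to be carried around.  It holds automatically when N
   is normal in K, and the carrier is then exactly left_cosets K N. *)
Definition is_quotient_elt (C : set G) :=
  exists x : G, [/\ x \in K, normalises x & C = left_coset x N].

Record quotient_group := QuotientGroup {
  quotient_carrier : set G;
  _ : `[< is_quotient_elt quotient_carrier >]
}.
HB.instance Definition _ := [isSub for quotient_carrier].
HB.instance Definition _ := [Choice of quotient_group by <:].

Implicit Types C D : set G.

Definition coset_mul C D : set G := [set x * y | x in C & y in D].
Definition coset_inv C : set G := [set x^-1 | x in C].

Lemma normalises1 : normalises 1.
Proof. by move=> y; rewrite conjg1. Qed.

Lemma normalisesM x y : normalises x -> normalises y -> normalises (x * y).
Proof. by move=> nx ny z; rewrite conjgM ny nx. Qed.

Lemma normalisesV x : normalises x -> normalises x^-1.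
Proof. by move=> nx z; rewrite -(nx (z ^ x^-1)) -conjgM mulVg conjg1. Qed.

Lemma coset_mulE x y : normalises y ->
  coset_mul (left_coset x N) (left_coset y N) = left_coset (x * y) N.
Proof.
move=> ny; apply/seteqP; split=> z /=.
  move=> [_ [a /= aN <-]] [_ [b /= bN <-]] <-.
  exists (a ^ y * b); first by rewrite /= gpredM ?ny.
  by rewrite /conjg !mulgA mulgK.
move=> [b /= bN <-]; exists x; first by exists 1; rewrite /= ?mulg1 ?gpred1.
by exists (y * b); [exists b | rewrite mulgA].
Qed.

Lemma coset_invE x : normalises x -> coset_inv (left_coset x N) = left_coset x^-1 N.
Proof.
move=> nx; apply/seteqP; split=> z /=.
  move=> [_ [a /= aN <-] <-]; exists (a^-1 ^ x^-1).
    by rewrite /= normalisesV // gpredV.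
  by rewrite /conjg invgK invgM !mulgA mulVg mul1g.
move=> [a /= aN <-]; exists (x * (a^-1 ^ x)).
  by exists (a^-1 ^ x); rewrite //= nx gpredV.
by rewrite /conjg !mulgA mulgV mul1g invgM invgK.
Qed.

Lemma quotient_mul_subproof (A B : quotient_group) :
  `[< is_quotient_elt (coset_mul (val A) (val B)) >].
Proof.
apply/asboolP; have [/asboolP[x [xK nx ->]] /asboolP[y [yK ny ->]]] :=
  (valP A, valP B).
by exists (x * y); rewrite gpredM // coset_mulE //; split=> //; apply: normalisesM.
Qed.

Lemma quotient_one_subproof : `[< is_quotient_elt (left_coset 1 N) >].
Proof. by apply/asboolP; exists 1; rewrite gpred1; split=> //; apply: normalises1. Qed.

Lemma quotient_inv_subproof (A : quotient_group) :
  `[< is_quotient_elt (coset_inv (val A)) >].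
Proof.
apply/asboolP; have /asboolP[x [xK nx ->]] := valP A.
by exists x^-1; rewrite gpredV coset_invE //; split=> //; apply: normalisesV.
Qed.

Definition quotient_mul (A B : quotient_group) : quotient_group :=
  QuotientGroup (quotient_mul_subproof A B).
Definition quotient_one : quotient_group := QuotientGroup quotient_one_subproof.
Definition quotient_inv (A : quotient_group) : quotient_group :=
  QuotientGroup (quotient_inv_subproof A).

Lemma quotient_mulA : associative quotient_mul.
Proof.
move=> A B C; apply: val_inj => /=.
have [/asboolP[x [_ nx ->]] /asboolP[y [_ ny ->]]] := (valP A, valP B).
have /asboolP[z [_ nz ->]] := valP C.
by rewrite !coset_mulE ?mulgA //; apply: normalisesM.
Qed.

Lemma quotient_mul1 : left_id quotient_one quotient_mul.
Proof.
move=> A; apply: val_inj => /=; have /asboolP[x [_ nx ->]] := valP A.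
by rewrite coset_mulE ?mul1g.
Qed.

Lemma quotient_mulr1 : right_id quotient_one quotient_mul.
Proof.
move=> A; apply: val_inj => /=; have /asboolP[x [_ nx ->]] := valP A.
by rewrite coset_mulE ?mulg1 //; apply: normalises1.
Qed.

Lemma quotient_mulV : left_inverse quotient_one quotient_inv quotient_mul.
Proof.
move=> A; apply: val_inj => /=; have /asboolP[x [_ nx ->]] := valP A.
by rewrite coset_invE // coset_mulE ?mulVg.
Qed.

Lemma quotient_mulrV : right_inverse quotient_one quotient_inv quotient_mul.
Proof.
move=> A; apply: val_inj => /=; have /asboolP[x [_ nx ->]] := valP A.
by rewrite coset_invE // coset_mulE ?mulgV //; apply: normalisesV.
Qed.

HB.instance Definition _ := isGroup.Build quotient_group
  quotient_mulA quotient_mul1 quotient_mulr1 quotient_mulV quotient_mulrV.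

End Quotient.

Definition is_free_basis (F : groupType) (X : Type) (b : X -> F) :=
  forall (H : groupType) (h : X -> H),
    exists2 p : {multiplicative F -> H}, p \o b =1 h &
      forall q : {multiplicative F -> H}, q \o b =1 h -> q =1 p.

Definition is_free (F : groupType) := exists (X : Type) (b : X -> F), is_free_basis b.

Definition finitely_presented (G : groupType) :=
  exists (F : groupType) (n : nat) (b : 'I_n -> F) (r : seq F)
         (p : {multiplicative F -> G}),
    [/\ is_free_basis b, range p = [set: G] &
        p @^-1` [set 1] = normal_closure [set` r]].

(* Main.v *)
(** Let G be presented by n generators and finitely many relators.  A cocycle on
    the Cayley graph of G (a function on edges with trivial holonomy around the
    relators) integrates to a function on G.

    Large groups have such a series: if H maps onto a free group F with basis
    containing x <> y, let G_(i+1) be the common kernel of the homomorphisms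
    G_i -> F_p that factor through F, with p = p_i -> oo.  Cocycles supported on
    the edges labelled x and y of the coset graph of G_i, a space of dimension
    2m with m = [H : G_i], modulo coboundaries give [G_i : G_(i+1)] >= p^m, and
    then G_i / G_(i+1) has rank at least m.

    Conversely, let H >= N >= M be consecutive terms.  Since [H : N] exceeds
    q ^ (n [G : H]), two characters of H / N are within 1/q of each other on all
    edges of the coset graph of H.  Their difference lifts to a small real
    cocycle, closed because relators are short; cutting it at a well chosen level
    gives a class phi in H^1(N; Z) supported on at most n [G : N] / q edges.  As
    N / M has rank at least c [G : N], some quotient Q = N / K of N / M is trivial
    on all edges of relators that meet this cut, yet not trivial on some loop of the
    complement of the cut.  Sending an edge of the cut lying in the fibre q of Q
    to the letter t_q, and any other edge to 1, defines a homomorphism from K to the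
    free group on Q.  Its image is free by Nielsen-Schreier.  It is not cyclic:
    otherwise the loop above yields a nontrivial element of the free group fixed
    by a fixed-point-free permutation of the letters. *)
Require Import Defs.
From HB Require Import structures.
From mathcomp Require Import all_boot all_order all_algebra.
From mathcomp Require Import finmap.
From mathcomp Require Import all_classical all_reals all_analysis.
From mathcomp Require Import zify lra.

Set Implicit Arguments.
Unset Strict Implicit.
Unset Printing Implicit Defensive.

Import Order.TTheory GRing.Theory Num.Theory.
Import numFieldNormedType.Exports.

Local Open Scope classical_set_scope.
Local Open Scope group_scope.

(** * Subgroups and cosets *)


Section Homomorphisms.
Variables G H : groupType.

Lemma mult1 (f : {multiplicative G -> H}) : f 1 = 1.
Proof. by apply: (@mulgI _ (f 1)); rewrite -gmulfM !mulg1. Qed.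

Lemma multV (f : {multiplicative G -> H}) x : f x^-1 = (f x)^-1.
Proof. by apply: (@mulgI _ (f x)); rewrite -gmulfM !mulgV mult1. Qed.

Lemma hom_of_morph (f : G -> H) : {morph f : x y / x * y} ->
  exists g : {multiplicative G -> H}, g = f :> (G -> H).
Proof.
move=> fM.
pose m := isMultiplicative.Build G H f fM.
pose g : {multiplicative G -> H} := HB.pack f m.
by exists g.
Qed.

End Homomorphisms.

Lemma subgroup_of (G : groupType) (P : G -> Prop) :
  P 1 -> (forall x y, P x -> P y -> P (x * y)) -> (forall x, P x -> P x^-1) ->
  exists K : groupClosed G, forall x, x \in K <-> P x.
Proof.
move=> P1 PM PV; pose S := [pred x | `[< P x >]].
have S1 : 1 \in S by apply/asboolP.
have SM : {in S &, forall u v, u * v \in S}.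
  by move=> u v /asboolP Pu /asboolP Pv; apply/asboolP/PM.
have SV : {in S, forall u, u^-1 \in S} by move=> u /asboolP Pu; apply/asboolP/PV.
pose m1 := isMulClosed.Build G S SM.
pose m2 := isMul1Closed.Build G S S1.
pose m3 := isInvClosed.Build G S SV.
pose K : groupClosed G := HB.pack (S : {pred G}) m1 m2 m3.
by exists K => x; split=> /asboolP.
Qed.

Section Cosets.
Variable G : groupType.
Implicit Types (N K : groupClosed G) (x y : G).

Lemma left_cosetP x y N : left_coset x N y <-> x^-1 * y \in N.
Proof.
split=> [[z /= zN <-]|xyN]; first by rewrite mulKg.
by exists (x^-1 * y); rewrite ?mulVKg.
Qed.

Lemma left_coset_eq x y N : left_coset x N = left_coset y N <-> x^-1 * y \in N.
Proof.
split=> [E|xyN]; first by apply/left_cosetP; rewrite E; apply/left_cosetP; rewrite mulVg gpred1.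
apply/seteqP; split=> z /left_cosetP zN; apply/left_cosetP.
  have -> : y^-1 * z = (x^-1 * y)^-1 * (x^-1 * z) by rewrite invgM invgK -!mulgA mulVKg.
  by apply: gpredM zN; rewrite gpredV.
have -> : x^-1 * z = (x^-1 * y) * (y^-1 * z) by rewrite -!mulgA mulVKg.
exact: gpredM.
Qed.

(** The coset of 1 is treated apart so that [tau] is 1 on [N]. Then [(tau g)^-1 * g] equals [g] for
    [g] in [N], which serves to extend homomorphisms from [N] to functions on [G]. *)
Lemma coset_section N : exists tau : G -> G,
  [/\ tau 1 = 1, forall x, (tau x)^-1 * x \in N &
      forall x y, y \in N -> tau (x * y) = tau x].
Proof.
pose tau x := if x \in N then 1 else xget 1 (left_coset x N).
exists tau; split; first by rewrite /tau gpred1.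
  move=> x; rewrite /tau; case: ifPn => [xN|xN]; first by rewrite invg1 mul1g.
  case: xgetP => [y _ /left_cosetP xyN|/(_ x)]; last first.
    by case; apply/left_cosetP; rewrite mulVg gpred1.
  by rewrite -gpredV invgM invgK.
move=> x y yN; rewrite /tau gpredMr //; case: ifP => // _.
by congr xget; apply/left_coset_eq; rewrite invgM mulgVK gpredV.
Qed.

Definition transversal (K : {pred G}) N (s : seq G) :=
  [/\ {subset s <= K}, forall x, x \in K -> exists2 y, y \in s & y^-1 * x \in N &
      {in s &, forall x y, x^-1 * y \in N -> x = y}].

Lemma transversal_uniqP (K : {pred G}) N : finite_set (left_cosets K N) ->
  exists s, [/\ transversal K N s, uniq s & size s = subgroup_index K N].
Proof.
move=> fin; pose C := fset_set (left_cosets K N).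
pose r (c : set G) := xget 1 [set x | x \in K /\ c = left_coset x N].
have rP c : c \in C -> r c \in K /\ c = left_coset (r c) N.
  rewrite in_fset_set // inE => -[x /= xK <-].
  rewrite /r; case: xgetP => [y _ //|/(_ x)]; case; split=> //.
have r_inj : {in C &, injective r}.
  by move=> c d /rP[_ {2}->] /rP[_ {2}->] ->.
exists [seq r c | c <- C]; split; last by rewrite size_map.
  split.
  - by move=> _ /mapP[c cC ->]; have [] := rP c cC.
  - move=> x xK; have xC : left_coset x N \in C.
      by rewrite in_fset_set // inE; exists x.
    exists (r (left_coset x N)); first exact: map_f.
    by apply/left_coset_eq; have [_ <-] := rP _ xC.
  - move=> _ _ /mapP[c cC ->] /mapP[d dC ->] /left_coset_eq E.
    by congr r; have [_ ->] := rP c cC; have [_ ->] := rP d dC.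
by rewrite map_inj_in_uniq ?fset_uniq.
Qed.

Lemma covering_index (K : {pred G}) N (s : seq G) :
  (forall x, x \in K -> exists2 y, y \in s & y^-1 * x \in N) ->
  finite_set (left_cosets K N) /\ subgroup_index K N <= size s.
Proof.
move=> cov; pose C := seq_fset tt [seq left_coset x N | x <- s].
have sub : left_cosets K N `<=` [set` C].
  move=> _ [x /= xK <-]; have [y ys yxN] := cov x xK.
  by rewrite /= seq_fsetE; apply/mapP; exists y => //; apply/esym/left_coset_eq.
have fin : finite_set (left_cosets K N) by apply: sub_finite_set sub _; exact: finite_fset.
split=> //; apply: (@leq_trans #|` C|).
  apply: fsubset_leq_card; apply/fsubsetP => c.
  by rewrite in_fset_set // inE => /sub.
by rewrite size_seq_fset (leq_trans (size_undup _)) ?size_map.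
Qed.

End Cosets.

(** * Potentials on Cayley graphs *)

Section Subgroup.
Variables (G : groupType) (K : groupClosed G).

Definition subgroup : Type := {x : G | x \in K}.
HB.instance Definition _ := SubChoice.on subgroup.

Lemma subgroup_closed : group_closed (fun x => x \in K).
Proof. by split=> [|x y xK yK]; [exact: gpred1 | exact: gpredF]. Qed.

HB.instance Definition _ :=
  SubChoice_isSubGroup.Build G (fun x => x \in K) subgroup subgroup_closed.

Definition in_subgroup x (xK : x \in K) : subgroup := exist (fun x => x \in K) x xK.

End Subgroup.

Section Wreath.
Variables A G : groupType.

(** The first component of a homomorphism into this group with second component [p] is a cocycle:
    [c (x * y) g = c x (p y * g) * c y g]. *)
Definition wreath : Type := ((G -> A) * G)%type.
HB.instance Definition _ := Choice.on wreath.

Definition wreath_mul (u v : wreath) : wreath :=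
  (fun g => u.1 (v.2 * g) * v.1 g, u.2 * v.2).
Definition wreath_one : wreath := (fun=> 1, 1).
Definition wreath_inv (u : wreath) : wreath := (fun g => (u.1 (u.2^-1 * g))^-1, u.2^-1).

Lemma wreath_mulA : associative wreath_mul.
Proof.
move=> [u x] [v y] [w z]; rewrite /wreath_mul /= mulgA; congr pair.
by apply/funext => g; rewrite !mulgA.
Qed.

Lemma wreath_mul1 : left_id wreath_one wreath_mul.
Proof.
by move=> [u x]; rewrite /wreath_mul /= mul1g; congr pair; apply/funext => g; rewrite mul1g.
Qed.

Lemma wreath_mulr1 : right_id wreath_one wreath_mul.
Proof.
by move=> [u x]; rewrite /wreath_mul /= mulg1; congr pair; apply/funext => g; rewrite mulg1 mul1g.
Qed.

Lemma wreath_mulV : left_inverse wreath_one wreath_inv wreath_mul.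
Proof.
move=> [u x]; rewrite /wreath_mul /wreath_one /= mulVg; congr pair.
by apply/funext => g; rewrite mulKg mulVg.
Qed.

Lemma wreath_mulrV : right_inverse wreath_one wreath_inv wreath_mul.
Proof.
move=> [u x]; rewrite /wreath_mul /wreath_one /= mulgV; congr pair.
by apply/funext => g; rewrite mulgV.
Qed.

HB.instance Definition _ := isGroup.Build wreath
  wreath_mulA wreath_mul1 wreath_mulr1 wreath_mulV wreath_mulrV.

End Wreath.

Section Words.
Variables (X : Type) (G : groupType) (gen : X -> G).

Definition letter (l : X * bool) : G := if l.2 then gen l.1 else (gen l.1)^-1.
Definition weval (W : seq (X * bool)) : G := foldr (fun l g => letter l * g) 1 W.

(* The edge (a, h) of the Cayley graph joins h to gen a * h.  A word is read
   from right to left. *)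
Fixpoint edges (W : seq (X * bool)) (g : G) : seq (X * G) :=
  if W is l :: W' then
    (l.1, if l.2 then weval W' * g else (gen l.1)^-1 * (weval W' * g)) :: edges W' g
  else [::].

Definition generating := forall g, exists W, g = weval W.

Lemma weval_cat W W' : weval (W ++ W') = weval W * weval W'.
Proof. by elim: W => [|l W IH] /=; rewrite ?mul1g // IH mulgA. Qed.

Lemma generating_ind (P : G -> Prop) : generating ->
  P 1 -> (forall a g, P g <-> P (gen a * g)) -> forall g, P g.
Proof.
move=> genG P1 Pgen g; have [W ->] := genG g.
elim: W => // -[a []] W IH /=; first exact: (Pgen a _).1.
by apply/(Pgen a); rewrite /letter /= mulVKg.
Qed.

Variables (A : groupType) (w : X -> G -> A).

Fixpoint holonomy (W : seq (X * bool)) (g : G) : A :=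
  if W is l :: W' then
    (if l.2 then w l.1 (weval W' * g)
     else (w l.1 ((gen l.1)^-1 * (weval W' * g)))^-1) * holonomy W' g
  else 1.

Definition is_potential (eta : G -> A) :=
  eta 1 = 1 /\ forall a g, eta (gen a * g) = w a g * eta g.

(** Here [eta] integrates [w] along the edges of one path only, so that different relators may be
    treated with different local solutions. *)
Lemma holonomyE W g (eta : G -> A) :
  (forall a h, List.In (a, h) (edges W g) -> eta (gen a * h) = w a h * eta h) ->
  eta (weval W * g) = holonomy W g * eta g.
Proof.
elim: W => [|[a b] W IH] /= E; first by rewrite !mul1g.
rewrite -!mulgA -IH => [|c h ch]; last by apply: E; right.
have := E _ _ (or_introl erefl); rewrite /letter /=.
by case: b {E} => [<-//|]; rewrite mulVKg => ->; rewrite mulKg.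
Qed.

(** For fixed [n] both sides satisfy the same recursion along edges and agree at 1. In particular
    [eta] restricts to a homomorphism on [N]. *)
Lemma potential_mul (N : groupClosed G) eta : generating -> is_potential eta ->
  (forall a g n, n \in N -> w a (g * n) = w a g) ->
  forall g n, n \in N -> eta (g * n) = eta g * eta n.
Proof.
move=> genG [eta1 etaM] wN g n nN; move: g; apply: generating_ind => //.
  by rewrite mul1g eta1 mul1g.
move=> a g; rewrite -mulgA !etaM wN // -mulgA.
by split=> [->//|/mulgI].
Qed.

End Words.

(* A presented group acts on G -> A and G through the wreath product, so a
   function on the edges of the Cayley graph with trivial holonomy around the
   relators integrates to a potential. *)
Definition simply_connected X (G : groupType) (gen : X -> G) (rels : seq (seq (X * bool))) :=
  forall (A : groupType) (w : X -> G -> A),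
    (forall r, List.In r rels -> forall g, holonomy gen w r g = 1) ->
    exists eta, is_potential gen w eta.

Section Presentation.
Variables (F : groupType) (X : Type) (b : X -> F).
Hypothesis bF : is_free_basis b.

(** The values of words form a subgroup [K]. The homomorphism from [F] to [K] that fixes the basis,
    followed by the inclusion, is the identity by uniqueness. *)
Lemma free_generating : generating b.
Proof.
move=> x; have [K KE] : exists K : groupClosed F, forall y, y \in K <-> exists W, y = weval b W.
  apply: subgroup_of => [|_ _ [W ->] [W' ->]|_ [W ->]]; first by exists [::].
    by exists (W ++ W'); rewrite weval_cat.
  exists (rev [seq (l.1, ~~ l.2) | l <- W]).
  elim: W => [|[a s] W IH] /=; first by rewrite invg1.
  rewrite rev_cons -cats1 weval_cat -IH /= mulg1 invgM; congr (_ * _).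
  by case: s; rewrite /letter //= invgK.
apply/KE.
have bK a : b a \in K by apply/KE; exists [:: (a, true)]; rewrite /weval /= mulg1.
have [P Pb _] := bF (fun a => in_subgroup (bK a)).
have vP : {morph (fun y => val (P y)) : y z / y * z} by move=> y z; rewrite gmulfM.
have [Q QE] := hom_of_morph vP.
have [I _ IU] := bF b.
have <- : Q x = x.
  rewrite (IU Q) => [|a]; last by rewrite /= QE; have /= -> := Pb a.
  by rewrite -(IU idfun).
by rewrite QE; exact: valP.
Qed.


Variables (G : groupType) (p : {multiplicative F -> G}).

(** [c] is the first component of the homomorphism to the wreath product sending [b a] to
    [(w a, p (b a))]. Uniqueness identifies its second component with [p]. *)
Lemma wreath_lift (A : groupType) (w : X -> G -> A) : exists c : F -> G -> A,
  (forall x y g, c (x * y) g = c x (p y * g) * c y g) /\ forall a g, c (b a) g = w a g.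
Proof.
pose h a : wreath A G := (w a, p (b a)).
have [P Pb _] := bF h.
have [q qb qU] := bF (p \o b).
have pq : p =1 q by apply: qU.
have snd_mul : {morph (fun x => (P x).2) : x y / x * y} by move=> x y; rewrite gmulfM.
have [P2 P2E] := hom_of_morph snd_mul.
have P2p x : (P x).2 = p x.
  rewrite pq -[LHS](congr1 (fun f => f x) P2E); apply: qU => a.
  by rewrite /= P2E; have /= -> := Pb a.
exists (fun x => (P x).1); split=> [x y g|a g]; last by have /= -> := Pb a.
by rewrite gmulfM /= P2p.
Qed.

End Presentation.

Lemma In_mem (T : eqType) (x : T) (s : seq T) : List.In x s -> x \in s.
Proof. by elim: s => //= y s IH [->|/IH]; rewrite inE ?eqxx // => ->; rewrite orbT. Qed.

Lemma In_map (X : Type) (T : eqType) (f : X -> T) (s : seq X) y :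
  y \in [seq f x | x <- s] <-> exists2 x, List.In x s & y = f x.
Proof.
elim: s => [|x s IH] /=; first by split=> [//|[]].
rewrite inE; split=> [/orP[/eqP->|/IH[z zs ->]]|[z [->|zs] yz]].
- by exists x => //; left.
- by exists z => //; right.
- by rewrite yz eqxx.
- by apply/orP; right; apply/IH; exists z.
Qed.

Section SimplyConnected.
Variables (F : groupType) (X : Type) (b : X -> F).
Hypothesis bF : is_free_basis b.

Section Lift.
Variables (G A : groupType) (p : {multiplicative F -> G}) (w : X -> G -> A).
Variable c : F -> G -> A.
Hypothesis cM : forall x y g, c (x * y) g = c x (p y * g) * c y g.
Hypothesis cb : forall a g, c (b a) g = w a g.

Lemma lift1 g : c 1 g = 1.
Proof.
have := cM 1 1 g; rewrite mulg1 mult1 mul1g => E.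
by apply: (@mulgI _ (c 1 g)); rewrite -E mulg1.
Qed.

Lemma liftV x g : c x^-1 g = (c x ((p x)^-1 * g))^-1.
Proof.
have := cM x x^-1 g; rewrite mulgV lift1 multV => E.
by apply: (@mulgI _ (c x ((p x)^-1 * g))); rewrite -E mulgV.
Qed.

Lemma weval_lift W : weval (p \o b) W = p (weval b W).
Proof.
elim: W => [|[a []] W IH] /=; first by rewrite mult1.
  by rewrite gmulfM IH.
by rewrite gmulfM IH /letter /= multV.
Qed.

Lemma holonomy_lift W g : holonomy (p \o b) w W g = c (weval b W) g.
Proof.
elim: W g => [|[a s] W IH] g /=; first by rewrite lift1.
rewrite cM IH weval_lift; case: s; rewrite /letter /= ?cb // liftV cb //.
Qed.

End Lift.

Lemma free_potential (A : groupType) (w : X -> F -> A) : exists eta, is_potential b w eta.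
Proof.
have [c [cM cb]] := wreath_lift bF idfun w.
exists (fun g => c g 1); split; first exact: (lift1 cM).
by move=> a g; rewrite cM mulg1 cb.
Qed.

Variables (G : groupType) (p : {multiplicative F -> G}) (rels : seq (seq (X * bool))).
Hypothesis p_surj : range p = [set: G].
Hypothesis p_ker : p @^-1` [set 1] = normal_closure [set` [seq weval b r | r <- rels]].

Lemma presentation_generating : generating (p \o b).
Proof.
move=> g; have [x _ <-] : range p g by rewrite p_surj.
by have [W ->] := free_generating bF x; exists W; rewrite weval_lift.
Qed.

(** The elements of the kernel of [p] at which the cocycle [c] is trivial form a normal subgroup
    containing the relators, hence the whole kernel. So [c x 1] depends only on [p x] and descends
    to a potential on [G]. *)
Lemma presentation_simply_connected : simply_connected (p \o b) rels.
Proof.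
move=> A w w1; have [c [cM cb]] := wreath_lift bF p w.
have [N NE] : exists N : groupClosed F, forall x, x \in N <-> p x = 1 /\ forall g, c x g = 1.
  apply: subgroup_of => [|x y [px cx] [py cy]|x [px cx]].
  - by rewrite mult1; split=> // g; rewrite (lift1 cM).
  - by rewrite gmulfM px py mulg1; split=> // g; rewrite cM cx cy mulg1.
  - by rewrite multV px invg1; split=> // g; rewrite (liftV cM) cx invg1.
have NJ : is_normal predT N.
  split=> // x y _ /NE[py cy]; apply/NE; split.
    by rewrite /conjg !gmulfM py mul1g -gmulfM mulVg mult1.
  move=> g; rewrite /conjg !cM cy mul1g gmulfM py mul1g -cM mulVg; exact: (lift1 cM).
have relsN : [set` [seq weval b r | r <- rels]] `<=` [set` N].
  move=> x /= xr; apply/NE.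
  have /In_map[r rr ->] := xr.
  have hol g : c (weval b r) g = 1 by rewrite -(holonomy_lift cM cb) w1.
  split=> //; have : (p @^-1` [set 1]) (weval b r); last by [].
  by rewrite p_ker => K [_]; apply; apply/In_map; exists r.
have kerN x : p x = 1 -> forall g, c x g = 1.
  move=> px; suff : x \in N by case/NE.
  have : normal_closure [set` [seq weval b r | r <- rels]] x by rewrite -p_ker.
  by apply; split.
have ceq x y : p x = p y -> c x 1 = c y 1.
  move=> pxy; rewrite -(mulgVK y x) cM kerN ?mul1g // gmulfM multV pxy mulgV //.
have lift g : exists x, p x = g .
  by have [x _ <-] : range p g; [rewrite p_surj | exists x].
have [s sp] := choice lift.
exists (fun g => c (s g) 1); split; first by rewrite kerN ?sp.
by move=> a g; rewrite (@ceq _ (b a * s g)) ?gmulfM ?sp // cM cb mulg1 sp.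
Qed.

End SimplyConnected.

Lemma finitely_presented_simply_connected (G : groupType) : finitely_presented G ->
  exists n (gen : 'I_n -> G) rels,
    [/\ generating gen, forall r, r \in rels -> weval gen r = 1 & simply_connected gen rels].
Proof.
move=> [F [n [b [r [p [bF p_surj p_ker]]]]]].
have [rels rE] : exists rels, r = [seq weval b r | r <- rels].
  elim: r {p_ker} => [|x r [rels ->]]; first by exists [::].
  by have [W ->] := free_generating bF x; exists (W :: rels).
rewrite rE in p_ker; exists n, (p \o b), rels; split.
- exact: (presentation_generating bF p_surj).
- move=> W Wr; rewrite weval_lift.
  have : (p @^-1` [set 1]) (weval b W) by rewrite p_ker => K [_]; apply; exact: map_f.
  by [].
- exact: (presentation_simply_connected bF p_surj p_ker).
Qed.

(** * Free groups *)

Section FreeGroup.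
Variable X : choiceType.
Implicit Types (l m : X * bool) (u v : seq (X * bool)).

Definition flip l := (l.1, ~~ l.2).
Definition reduced u := sorted (fun l m => m != flip l) u.

(** Left multiplication of a reduced word by one letter. Words multiply by acting on reduced words,
    so that associativity follows from [pushK] without any confluence argument. *)
Definition push l u :=
  if u is m :: u' then if m == flip l then u' else l :: u else [:: l].
Definition act u v := foldr push v u.

Lemma flipK : involutive flip.
Proof. by case=> x b; rewrite /flip /= negbK. Qed.

Lemma reduced_behead l u : reduced (l :: u) -> reduced u.
Proof. exact: path_sorted. Qed.

Lemma push_reduced l u : reduced u -> reduced (push l u).
Proof.
case: u => //= m u uP; case: ifPn => [_|ml]; first exact: path_sorted uP.
by rewrite /= ml.
Qed.

Lemma push_cons l u : reduced (l :: u) -> push l u = l :: u.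
Proof. by case: u => //= m u /andP[/negPf->]. Qed.

Lemma pushK l u : reduced u -> push (flip l) (push l u) = u.
Proof.
case: u => [|m u] /=; first by rewrite flipK eqxx.
case: eqP => [-> uP|_ _]; first exact: push_cons.
by rewrite /= flipK eqxx.
Qed.

Lemma act_reduced u v : reduced v -> reduced (act u v).
Proof. by move=> vP; elim: u => //= l u; exact: push_reduced. Qed.

Lemma act_push l u v : reduced v -> act (push l u) v = push l (act u v).
Proof.
move=> vP; case: u => //= m u; case: eqP => //= ->.
by rewrite -{1}[l]flipK pushK // act_reduced.
Qed.

Lemma actA u v w : reduced w -> act u (act v w) = act (act u v) w.
Proof. by move=> wP; elim: u => //= l u ->; rewrite act_push. Qed.

Lemma actu0 u : reduced u -> act u [::] = u.
Proof.
elim: u => //= l u IH luP; rewrite IH ?push_cons //; exact: path_sorted luP.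
Qed.

Definition word_inv u := rev (map flip u).

Lemma word_invK : involutive word_inv.
Proof. by move=> u; rewrite /word_inv map_rev revK mapK //; exact: flipK. Qed.

Lemma word_inv_reduced u : reduced u -> reduced (word_inv u).
Proof.
rewrite /reduced /word_inv rev_sorted sorted_map.
by apply: sub_sorted => l m /=; rewrite flipK; apply: contraNneq => ->.
Qed.

Lemma act_word_inv u : reduced u -> act (word_inv u) u = [::].
Proof.
elim: u => // l u IH luP; have uP := reduced_behead luP.
rewrite /word_inv /= rev_cons /act foldr_rcons -(push_cons luP) pushK //.
exact: IH.
Qed.

Definition free_group : Type := {u : seq (X * bool) | reduced u}.
HB.instance Definition _ := SubChoice.on free_group.
Implicit Types f g : free_group.

Definition free_mul f g : free_group := Sub (act (val f) (val g)) (act_reduced _ (valP g)).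
Definition free_one : free_group := Sub [::] isT.
Definition free_inv f : free_group := Sub (word_inv (val f)) (word_inv_reduced (valP f)).

Lemma free_mulA : associative free_mul.
Proof. by move=> f g h; apply: val_inj; rewrite /= actA ?(valP h). Qed.
Lemma free_mul1 : left_id free_one free_mul.
Proof. by move=> f; apply: val_inj. Qed.
Lemma free_mulr1 : right_id free_one free_mul.
Proof. by move=> f; apply: val_inj; rewrite /= actu0 ?(valP f). Qed.
Lemma free_mulV : left_inverse free_one free_inv free_mul.
Proof. by move=> f; apply: val_inj; rewrite /= act_word_inv ?(valP f). Qed.
Lemma free_mulrV : right_inverse free_one free_inv free_mul.
Proof.
move=> f; apply: val_inj; rewrite /= -{1}[val f]word_invK.
by rewrite act_word_inv // word_inv_reduced ?(valP f).
Qed.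

HB.instance Definition _ := isGroup.Build free_group
  free_mulA free_mul1 free_mulr1 free_mulV free_mulrV.

Definition free_gen (x : X) : free_group := Sub [:: (x, true)] isT.

Lemma val_letter l : val (letter free_gen l) = [:: l].
Proof. by case: l => x []. Qed.

Lemma val_letter_mul l f : val (letter free_gen l * f) = push l (val f).
Proof. by rewrite [LHS]/= -[in RHS](actu0 (valP f)) /= val_letter /= actu0 ?(valP f). Qed.

Lemma free_group_ind (P : free_group -> Prop) : P 1 ->
  (forall l f, reduced (l :: val f) -> P f -> P (letter free_gen l * f)) ->
  forall f, P f.
Proof.
move=> P1 Pl [u uP]; elim: u uP => [|l u IH] uP.
  by rewrite (_ : exist _ _ _ = 1 :> free_group) //; apply: val_inj.
have uP' := reduced_behead uP.
rewrite (_ : exist _ _ _ = letter free_gen l * (Sub u uP' : free_group) :> free_group).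
  by apply: Pl; [exact: uP | exact: IH].
by apply: val_inj; rewrite val_letter_mul /= push_cons.
Qed.

Lemma free_gen_basis : is_free_basis free_gen.
Proof.
move=> H h.
have pushE l u : weval h (push l u) = letter h l * weval h u.
  case: u => //= m u; case: eqP => //= ->; rewrite mulgA.
  by case: l => x []; rewrite /letter /= ?mulgV ?mulVg mul1g.
have evM : {morph (fun f : free_group => weval h (val f)) : f g / f * g}.
  move=> f g; rewrite /=; elim: (val f) => [|l u IH] /=; first by rewrite mul1g.
  by rewrite pushE IH mulgA.
have [p pE] := hom_of_morph evM; exists p => [x|q qE f].
  by rewrite /= pE /= mulg1.
elim/free_group_ind: f => [|l f _ IH]; first by rewrite !mult1.
rewrite !gmulfM IH; congr (_ * _).
have {}qE x : q (free_gen x) = p (free_gen x) by have /= -> := qE x; rewrite pE /= mulg1.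
by case: l => x []; rewrite /letter /= ?multV qE.
Qed.

(** Since [s] is injective, [p] acts letter by letter on reduced words without creating
    cancellations. The first letter of a fixed nonempty word would be a fixed point of [s]. *)
Lemma free_relabel_fixed (s : X -> X) (p : {multiplicative free_group -> free_group}) f :
  injective s -> (forall x, s x != x) -> (forall x, p (free_gen x) = free_gen (s x)) ->
  p f = f -> f = 1.
Proof.
move=> s_inj sx ps.
have vp g : val (p g) = [seq (s l.1, l.2) | l <- val g].
  elim/free_group_ind: g => [|l g lgP IH]; first by rewrite mult1.
  have -> : p (letter free_gen l * g) = letter free_gen (s l.1, l.2) * p g.
    by rewrite gmulfM; case: (l) => x []; rewrite /letter /= ?multV ps.
  rewrite !val_letter_mul IH [in RHS]push_cons // push_cons //=.
  move: lgP => /=; case: (sval g) => //= m u /andP[ml uP]; apply/andP; split.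
    by apply: contraNneq ml => -[/s_inj m1 m2]; rewrite [m]surjective_pairing m1 m2.
  elim: u m uP {ml} => //= m' u IH' m /andP[mm' uP]; rewrite IH' // andbT.
  by apply: contraNneq mm' => -[/s_inj m1 m2]; rewrite [m']surjective_pairing m1 m2.
move=> pf; apply: val_inj => /=; have := vp f; rewrite pf /=.
by case: (sval f) => //= -[x b] u [] /esym/eqP; rewrite (negPf (sx x)).
Qed.

End FreeGroup.

Section IntPower.
Variable G : groupType.
Implicit Types (x : G) (d e : int).

Definition zpow x d : G := match d with Posz n => x ^+ n | Negz n => x ^- n.+1 end.

Lemma zpowS x d : zpow x (1 + d)%R = x * zpow x d.
Proof.
case: d => [n|[|n]].
- by rewrite (_ : (1 + Posz n)%R = Posz n.+1) //= expgS.
- by rewrite (_ : (1 + Negz 0)%R = 0%R) //= mulgV.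
- have -> : (1 + Negz n.+1)%R = Negz n by lia.
  by rewrite /zpow [in RHS]expgSr invgM mulVKg.
Qed.

Lemma zpowB1 x d : zpow x (d - 1)%R = x^-1 * zpow x d.
Proof. by rewrite -[d in RHS](subrK 1%R) [in RHS]addrC zpowS mulKg. Qed.

Lemma zpowD x d e : zpow x (d + e)%R = zpow x d * zpow x e.
Proof.
elim/int_rec: d => [|n IH|n IH]; first by rewrite add0r /= mul1g.
  by rewrite -addn1 PoszD addrAC addrC zpowS IH mulgA -zpowS addrC.
rewrite -addn1 PoszD opprD addrAC zpowB1 IH mulgA -zpowB1 //.
Qed.

End IntPower.

(** The exponent sum, from the universal property with target the additive group of integers. *)
Lemma free_exponent (X : choiceType) : exists eps : free_group X -> int,
  [/\ forall f g, eps (f * g) = (eps f + eps g)%R, forall x, eps (free_gen x) = 1%R &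
      forall x d, eps (zpow (free_gen x) d) = d].
Proof.
have [p pE _] := @free_gen_basis X (Algebra.to_multiplicative int) (fun=> 1%R).
have pM f g : p (f * g) = (p f + p g :> int)%R by rewrite gmulfM.
have p1 x : p (free_gen x) = 1%R := pE x.
exists p; split=> // x.
elim/int_rec => [|n IH|n IH].
- exact: (mult1 p).
- by rewrite -addn1 PoszD addrC zpowS pM IH p1.
- rewrite -addn1 PoszD opprD zpowB1 pM IH (_ : p _ = - 1)%R 1?addrC //.
  by rewrite multV p1.
Qed.

(** * Schreier transversals and the Nielsen-Schreier theorem *)

Section NielsenSchreier.
Variables (X : Type) (F : groupType) (b : X -> F).

(* The last clause says that the representatives form a subtree of the Cayley
   graph. *)
Lemma schreier_section (J : groupClosed F) : generating b -> exists tau : F -> F,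
  [/\ tau 1 = 1, forall g, (tau g)^-1 * g \in J,
      forall g j, j \in J -> tau (g * j) = tau g &
      forall P : F -> Prop, P 1 ->
        (forall x g, tau (b x * g) = b x * tau g -> P (tau g) <-> P (tau (b x * g))) ->
        forall g, P (tau g)].
Proof.
move=> genb.
(* [dist n C] says that [n] is the length of a shortest word with value in [C]. *)
pose reach n (C : set F) := exists2 W, size W = n & C (weval b W).
pose dist n C := reach n C /\ forall m, m < n -> ~ reach m C.
pose shift l (C : set F) : set F := [set y | C (letter b l * y)].
have dist_inj n m C : dist n C -> dist m C -> n = m.
  move=> [rn nn] [rm mm]; case: (ltngtP n m) => // lt; [by case: (mm _ lt)|by case: (nn _ lt)].
have /choice [N NP] : forall C, exists k, (exists n, dist n C) -> dist k C.
  by move=> C; have [[n nC]|H] := pselect (exists n, dist n C); [exists n|exists 0].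
have /choice [nxt nxtP] : forall C, exists s : option (X * bool), forall n, dist n.+1 C ->
    exists2 l, s = Some l & dist n (shift l C).
  move=> C.
  have [[n nC]|H] := pselect (exists n, dist n.+1 C); last first.
    by exists None => n nC; case: H; exists n.
  have [[[//|l W] [Wn] CW] Cmin] := nC; exists (Some l) => m mC; exists l => //.
  have [<-] := dist_inj _ _ _ nC mC; split; first by exists W.
  by move=> k kn [W' W'k CW']; apply: (Cmin k.+1); rewrite ?ltnS //; exists (l :: W'); rewrite /= ?W'k.
(* [nxt] gives the first letter of a shortest word. What remains after removing it represents a
   coset one step closer to 1, and the representative of that coset is used again, so the
   representatives form a tree. *)
pose fix rep (n : nat) (C : set F) {struct n} : F := if n is n'.+1 then
  (if nxt C is Some l then letter b l * rep n' (shift l C) else 1) else 1.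
have shiftE l g : shift l (left_coset g J) = left_coset ((letter b l)^-1 * g) J.
  by apply/seteqP; split=> y /left_cosetP yJ; apply/left_cosetP; move: yJ; rewrite invgM invgK mulgA.
have distN g : dist (N (left_coset g J)) (left_coset g J).
  apply: NP; have [W gW] := genb g.
  have ex : exists n, `[< reach n (left_coset g J) >].
    by exists (size W); apply/asboolP; exists W => //; apply/left_cosetP; rewrite gW mulVg gpred1.
  exists (ex_minn ex); case: ex_minnP => n /asboolP rn nmin; split=> // m mn rm.
  by have /nmin := asboolT rm; rewrite leqNgt mn.
pose tau g := rep (N (left_coset g J)) (left_coset g J).
have tauE n g : dist n (left_coset g J) -> tau g = rep n (left_coset g J).
  by move=> /(dist_inj _ _ _ (distN g)) E; rewrite /tau E.
have tau_inv g j : j \in J -> tau (g * j) = tau g.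
  move=> jJ; rewrite /tau (_ : left_coset (g * j) J = left_coset g J) //.
  by apply/left_coset_eq; rewrite invgM mulgVK gpredV.
have tau0 g : dist 0 (left_coset g J) -> tau g = 1 by move/tauE.
have tauS n g : dist n.+1 (left_coset g J) -> exists l,
    dist n (left_coset ((letter b l)^-1 * g) J) /\ tau g = letter b l * tau ((letter b l)^-1 * g).
  move=> gn; have [l ol nl] := nxtP _ _ gn; rewrite shiftE in nl; exists l; split=> //.
  by rewrite (tauE _ _ gn) (tauE _ _ nl) /= ol shiftE.
exists tau; split=> //.
- apply: tau0; split=> //; exists [::] => //.
  by apply/left_cosetP; rewrite invg1 mul1g gpred1.
- move=> g; move: (distN g); move: (N _) => n.
  elim: n g => [|n IH] g gn.
    rewrite (tau0 _ gn) invg1 mul1g; have [[[|//] _ /left_cosetP]] := gn.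
    by rewrite mulg1 gpredV.
  by have [l [/IH ln ->]] := tauS _ _ gn; rewrite invgM -mulgA.
- move=> P P1 Pb g; move: (distN g); move: (N _) => n.
  elim: n g => [|n IH] g gn; first by rewrite (tau0 _ gn).
  have [[x []] [/IH ln tl]] := tauS _ _ gn; rewrite /letter /= in ln tl.
    by have := Pb x ((b x)^-1 * g); rewrite mulVKg => /(_ tl) [+ _]; apply.
  rewrite invgK in ln tl; apply/(Pb x) => //.
  by rewrite tl mulVKg.
Qed.

Hypothesis bF : is_free_basis b.

(** The basis consists of the Schreier generators of the edges outside the tree. A map [h] on it
    becomes an edge labelling that is 1 on the tree; its potential is 1 on representatives and
    restricts to the required homomorphism on [J]. *)
Theorem nielsen_schreier (J : groupClosed F) : is_free (subgroup J).
Proof.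
have genb := free_generating bF.
have [tau [tau1 tauJ tau_inv tree]] := schreier_section J genb.
have tauK g : tau (tau g) = tau g.
  by rewrite -[in RHS](mulVKg (tau g) g) tau_inv.
have tau_mul x g : tau (x * tau g) = tau (x * g).
  by rewrite -[in RHS](mulVKg (tau g) g) mulgA [RHS]tau_inv.
pose edge (q : X * F) := q.2 = tau q.2 /\ tau (b q.1 * q.2) <> b q.1 * q.2.
have edgeJ (q : X * F) : (tau (b q.1 * q.2))^-1 * (b q.1 * q.2) \in J by exact: tauJ.
pose y (q : {q | edge q}) : subgroup J := in_subgroup (edgeJ (sval q)).
exists {q | edge q}, y => H h.
pose w0 q := if pselect (edge q) is left e then h (exist _ q e) else 1.
pose w x g := w0 (x, tau g).
have wE q : w (sval q).1 (sval q).2 = h q.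
  case: q => -[x g] /= e; rewrite /w -(proj1 e) /w0; case: pselect => // e'.
  by rewrite (Prop_irrelevance e' e).
have w_tree x g : tau (b x * g) = b x * tau g -> w x g = 1.
  by move=> t; rewrite /w /w0; case: pselect => // -[_ []] /=; rewrite tau_mul.
have [eta etaP] := free_potential bF w.
have etaM := potential_mul genb etaP (fun a g n nJ => congr1 (fun u => w0 (a, u)) (tau_inv g n nJ)).
case: (etaP) => eta1 etab.
have eta_tau : forall g, eta (tau g) = 1.
  apply: (tree (fun u => eta u = 1)) => // x g t; rewrite t etab w_tree ?mul1g //.
  by rewrite tau_mul tauK.
have pM : {morph (fun j : subgroup J => eta (val j)) : i j / i * j}.
  by move=> i j; rewrite -etaM ?(valP j).
have [p pE] := hom_of_morph pM.
have py : p \o y =1 h.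
  move=> q; rewrite /= pE /= -(wE q); case: q => -[x g] [/= gE _].
  have E : tau (b x * g) * ((tau (b x * g))^-1 * (b x * g)) = b x * g by rewrite mulVKg.
  have := congr1 eta E; rewrite etaM // eta_tau mul1g => ->.
  by rewrite etab gE eta_tau mulg1.
exists p => // q qy.
pose s g : subgroup J := in_subgroup (tauJ g).
(* Schreier rewriting: one step along an edge multiplies the [J]-part of [g] by a basis element or
   by 1, so two homomorphisms that agree on the basis agree on [J]. *)
have s_gen x g : exists e : subgroup J, q e = p e /\ s (b x * g) = e * s g.
  have [t|t] := pselect (tau (b x * g) = b x * tau g).
    exists 1; rewrite !mult1 mul1g; split=> //; apply: val_inj; rewrite /= t.
    by rewrite invgM -mulgA mulKg.
  have e : edge (x, tau g) by split; rewrite /= ?tauK ?tau_mul.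
  exists (y (exist _ _ e)); split; first exact: etrans (qy _) (esym (py _)).
  by apply: val_inj; rewrite /= tau_mul -!mulgA mulVKg.
have qps : forall g, q (s g) = p (s g).
  apply: (generating_ind genb) => [|x g].
    rewrite (_ : s 1 = 1) ?mult1 //; apply: val_inj.
    by rewrite /= tau1 invg1 mulg1.
  have [e [qe ->]] := s_gen x g; rewrite !gmulfM qe.
  by split=> [->|/mulgI].
move=> j; have <- : s (val j) = j.
  apply: val_inj; rewrite /= -[in tau _](mul1g (sval j)) tau_inv ?(valP j) //.
  by rewrite tau1 invg1 mul1g.
exact: qps.
Qed.

End NielsenSchreier.

(** * Commutativity in free groups *)

Section AbelianFree.
Variables (F : groupType) (X : Type) (b : X -> F).
Hypothesis bF : is_free_basis b.

(** Distinct basis elements could be sent to the two generators of a free group of rank 2, which do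
    not commute. *)
Lemma abelian_basis : is_abelian F -> forall x y, b x = b y.
Proof.
move=> abF x y; have [//|nxy] := pselect (b x = b y).
pose t := @free_gen bool.
have [p pE _] := bF (fun u => t `[< b u = b x >]).
have px : p (b x) = t true by rewrite [LHS](pE x); congr t; apply/asboolP.
have py : p (b y) = t false.
  by rewrite [LHS](pE y); congr t; apply/negbTE/asboolP => E; apply: nxy.
by have := congr1 (val \o p) (abF (b x) (b y)); rewrite /= !gmulfM px py.
Qed.

Lemma nonabelian_basis : ~ is_abelian F -> exists x y, b x <> b y.
Proof.
move=> nab; apply: contrapT => H; apply: nab => g h.
have beq x y : b x = b y by apply: contrapT => nxy; apply: H; exists x, y.
have genb := free_generating bF.
have comm x : forall g, commute (b x) g.
  apply: (generating_ind genb) => [|a u]; first exact: commute1.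
  rewrite (beq a x); split=> E; first exact: commuteM.
  by rewrite -(mulKg (b x) u); apply: commuteM E; apply/commuteV/commute_refl.
move: g; apply: (generating_ind genb) => [|a u]; first exact/commute_sym/commute1.
split=> E; apply: commute_sym.
  by apply: commuteM; apply: commute_sym => //; apply: comm.
rewrite -(mulKg (b a) u); apply: commuteM; last exact: commute_sym.
by apply: commuteV; apply: commute_sym; apply: comm.
Qed.

End AbelianFree.

Section Exponent.
Variables (F : groupType) (eps : F -> int).
Hypothesis epsM : forall f g, eps (f * g) = (eps f + eps g)%R.

Lemma additive1 : eps 1 = 0%R.
Proof. by have := epsM 1 1; rewrite mulg1 => /eqP; rewrite -[LHS]addr0 addrC; lia. Qed.

Lemma additiveV g : eps g^-1 = (- eps g)%R.
Proof. by have := epsM g g^-1; rewrite mulgV additive1; lia. Qed.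

Lemma additive_zpow g d : eps (zpow g d) = (d * eps g)%R.
Proof.
elim/int_rec: d => [|n IH|n IH]; first by rewrite mul0r additive1.
  by rewrite -addn1 PoszD addrC zpowS epsM IH mulrDl mul1r.
by rewrite -addn1 PoszD opprD zpowB1 epsM IH additiveV mulrBl mul1r addrC.
Qed.

(** All basis elements coincide, so every element is a power of a single one, on which [eps] cannot
    vanish because [eps z] is nonzero. *)
Lemma abelian_free_exponent_inj z : is_free F -> is_abelian F -> eps z <> 0%R ->
  forall g, eps g = 0%R -> g = 1.
Proof.
move=> [X [b bF]] abF z0.
have cyc : forall g, g = 1 \/ exists a d, g = zpow (b a) d.
  apply: (generating_ind (free_generating bF)) => [|a g]; first by left.
  split=> -[E|[c [d E]]].
  - by right; exists a, 1%R; rewrite E mulg1.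
  - by right; exists a, (1 + d)%R; rewrite E (abelian_basis bF abF c a) zpowS.
  - right; exists a, (-1)%R; apply: (@mulgI _ (b a)).
    by rewrite E -[(-1)%R]add0r zpowB1 mulVKg.
  - right; exists a, (d - 1)%R; rewrite zpowB1 (abelian_basis bF abF a c) -E.
    by rewrite (abelian_basis bF abF a c) mulKg.
have [z1|[a [d zE]]] := cyc z; first by rewrite z1 additive1 in z0.
have ea : eps (b a) <> 0%R by move=> ea; rewrite zE additive_zpow ea mulr0 in z0.
move=> g; have [//|[c [e ->]]] := cyc g.
rewrite (abelian_basis bF abF c a) additive_zpow => /eqP; rewrite mulf_eq0.
by case/orP=> /eqP // ->.
Qed.

End Exponent.

(** * Characters of finite abelian groups *)

Section Characters.
Variables (A : groupType) (k : nat).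
Hypotheses (abA : is_abelian A) (k_gt1 : 1 < k) (expA : forall a : A, a ^+ k = 1).
Implicit Types B : groupClosed A.

Lemma abelian_mulgACA (a b c d : A) : a * b * (c * d) = a * c * (b * d).
Proof. by rewrite -!mulgA; congr (_ * _); rewrite !mulgA (abA b). Qed.

Lemma abelian_invM (a b : A) : (a * b)^-1 = a^-1 * b^-1.
Proof. by rewrite invgM; exact: abA. Qed.

(** A count without orders of groups: [t] covers [B], possibly with redundancy, and there are as
    many distinct characters of [B] as entries of [t]. Characters are functions on [A] that are
    additive on [B]. *)
Definition many_characters B := exists (I : finType) (chi : I -> A -> 'Z_k) (t : seq A),
  [/\ size t = #|I|, forall a, a \in B -> a \in t,
      forall i, {in B &, forall a b, chi i (a * b) = (chi i a + chi i b)%R} &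
      forall i j, {in B, chi i =1 chi j} -> i = j].

Lemma trivial_characters : exists B, many_characters B.
Proof.
have [B BE] : exists B, forall a, a \in B <-> a = 1.
  by apply: subgroup_of => [//|_ _ -> ->|_ ->]; rewrite ?mulg1 ?invg1.
exists B, unit, (fun _ _ => 0%R), [:: 1]; split.
- by rewrite card_unit.
- by move=> a /BE ->; rewrite inE.
- by move=> *; rewrite addr0.
- by move=> [] [].
Qed.

(* A character of B extends to <B, x> in r ways, where r is the order of x
   modulo B: any y with r y = chi (x ^ r) may be the value at x. *)
Lemma extend_characters B x : many_characters B ->
  exists B', [/\ {subset B <= B'}, x \in B' & many_characters B'].
Proof.
move=> [I [chi [t [tI Bt chiM chi_inj]]]].
have [B' B'E] : exists B', forall g, g \in B' <-> exists e, g / x ^+ e \in B.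
  apply: subgroup_of => [|g h [d gB] [e hB]|g [e gB]].
  - by exists 0; rewrite divg1 gpred1.
  - exists (d + e).
    have -> : g * h / x ^+ (d + e) = (g / x ^+ d) * (h / x ^+ e).
      by rewrite expgnDr abelian_invM abelian_mulgACA.
    exact: gpredM.
  - exists (e * k.-1)%N.
    have -> : x ^+ (e * k.-1)%N = x ^- e.
      apply: (@mulgI _ (x ^+ e)); rewrite mulgV -expgnDr -mulnS prednK ?(ltnW k_gt1) //.
      by rewrite mulnC expgnA expA expg1n.
    by rewrite -abelian_invM gpredV.
have exr : exists r, (0 < r) && (x ^+ r \in B).
  by exists k; rewrite (ltnW k_gt1) expA gpred1.
pose r := ex_minn exr.
have [r0 xrB rmin] : [/\ 0 < r, x ^+ r \in B & forall m, 0 < m -> x ^+ m \in B -> r <= m].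
  by rewrite /r; case: ex_minnP => m /andP[m0 mB] H; split=> // m' ? ?; apply: H; apply/andP.
have xB m : x ^+ (m * r)%N \in B by rewrite mulnC expgnA gpredXn.
have e_uniq g d e : d < r -> e < r -> g / x ^+ d \in B -> g / x ^+ e \in B -> d = e.
  wlog: d e / d <= e => [W|de dr er gd ge].
    by case: (leqP d e) => [/W//|/ltnW ed dr er gd ge]; apply/esym/W.
  apply/eqP; rewrite eqn_leq de leqNgt; apply/negP => lt.
  have ed0 : 0 < e - d by rewrite subn_gt0.
  have ed : e - d < r by rewrite (leq_ltn_trans (leq_subr _ _) er).
  suff xed : x ^+ (e - d) \in B by have := rmin _ ed0 xed; rewrite leqNgt ed.
  have -> : x ^+ (e - d) = (g / x ^+ e)^-1 * (g / x ^+ d).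
    by rewrite expgnFr // invgM invgK -!mulgA mulKg.
  by apply: gpredM gd; rewrite gpredV.
have /choice [e eP] : forall g, exists e, g \in B' -> e < r /\ g / x ^+ e \in B.
  move=> g; have [/B'E[e ge]|gB'] := boolP (g \in B'); last by exists 0.
  exists (e %% r) => _; rewrite ltn_mod; split=> //.
  have -> : g / x ^+ (e %% r) = (g / x ^+ e) * x ^+ (e %/ r * r)%N.
    rewrite {2}(divn_eq e r) expgnDr abelian_invM -!mulgA; congr (_ * _).
    by rewrite (abA (x ^- (e %% r))) mulKg.
  exact: gpredM.
have eB g : g \in B -> e g = 0.
  move=> gB; have [er ge] : e g < r /\ g / x ^+ (e g) \in B.
    by apply: eP; apply/B'E; exists 0; rewrite divg1.
  by apply: (e_uniq g); rewrite ?divg1.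
have rk : r %| k.
  rewrite /dvdn; apply/negPn/negP; rewrite -lt0n => m0.
  have xm : x ^+ (k %% r) \in B.
    have : x ^+ k \in B by rewrite expA gpred1.
    by rewrite {1}(divn_eq k r) expgnDr gpredMl ?xB.
  by have := rmin _ m0 xm; rewrite leqNgt ltn_mod r0.
have kr0 : 0 < k %/ r by rewrite divn_gt0 // dvdn_leq // ltnW.
have k0 : (k%:R = 0 :> 'Z_k)%R by rewrite pchar_Zp.
(* The division is exact: multiplying [chi i (x ^+ r)] by [k %/ r] gives [chi i (x ^+ k)], which is
   0, so [r] divides its representative. *)
pose y i : 'Z_k := ((chi i (x ^+ r)%g %/ r)%:R)%R.
have chi1 i : chi i 1 = 0%R.
  have B1 : 1 \in B by exact: gpred1.
  by have := chiM i 1 1 B1 B1; rewrite mulg1 => /eqP; rewrite -subr_eq subrr => /eqP.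
have chiX i b m : b \in B -> chi i (b ^+ m)%g = (chi i b *+ m)%R.
  move=> bB; elim: m => [|m IH]; first by rewrite chi1.
  by rewrite expgS chiM ?gpredXn // IH mulrS.
have yP i : (y i *+ r = chi i (x ^+ r)%g)%R.
  rewrite /y -mulrnA divnK ?natr_Zp //.
  suff /(congr1 val) : ((chi i (x ^+ r)%g * (k %/ r))%N%:R = 0 :> 'Z_k)%R.
    rewrite [val _]val_Zp_nat //= => /eqP kdiv.
    have : r * (k %/ r) %| chi i (x ^+ r) * (k %/ r) by rewrite mulnC divnK.
    by rewrite dvdn_pmul2r.
  by rewrite mulrnA natr_Zp -chiX // -expgnA mulnC divnK // expA chi1.
(* The multiples of [z] are the solutions of [r z = 0]; adding them to [y i] yields the [r]
   extensions of [chi i]. *)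
pose z : 'Z_k := ((k %/ r)%:R)%R.
have zr : (z *+ r = 0)%R by rewrite /z -mulrnA divnK.
pose psi (q : I * 'I_r) g := (chi q.1 (g / x ^+ e g)%g + (y q.1 + z *+ q.2) *+ e g)%R.
have psiB q : {in B, psi q =1 chi q.1}.
  by move=> g gB; rewrite /psi eB // divg1 mulr0n addr0.
pose t' := [seq b * x ^+ nat_of_ord d | b <- t, d <- enum 'I_r].
have BB' : {subset B <= B'} by move=> g gB; apply/B'E; exists 0; rewrite divg1.
have xB' : x \in B' by apply/B'E; exists 1%N; rewrite mulgV gpred1.
exists B'; split=> //.
exists (I * 'I_r)%type, psi, t'; split.
- by rewrite size_allpairs card_prod tI size_enum_ord card_ord.
- move=> g /eP[er ge]; apply/allpairsP; exists (g / x ^+ e g, Ordinal er).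
  by rewrite /= mem_enum mulgVK; split=> //; exact: Bt.
- move=> q g h gB' hB'; have [eg gB] := eP _ gB'; have [eh hB] := eP _ hB'.
  have ghB' : g * h \in B' by exact: gpredM.
  have [egh ghB] := eP _ ghB'.
  pose c := (e g + e h) %/ r.
  have gh : g * h / x ^+ ((e g + e h) %% r) = (g / x ^+ e g) * (h / x ^+ e h) * x ^+ (c * r)%N.
    rewrite abelian_mulgACA -abelian_invM -expgnDr {2}(divn_eq (e g + e h) r).
    rewrite expgnDr abelian_invM -!mulgA.
    by rewrite (abA (x ^- ((e g + e h) %% r))) mulKg.
  have E : (e g + e h) %% r = e (g * h).
    by apply: (e_uniq (g * h)) => //; rewrite ?ltn_mod // gh; apply: gpredM => //; exact: gpredM.
  have eE : (e g + e h = c * r + e (g * h)%g)%N by rewrite -E -divn_eq.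
  have ghB2 : (g / x ^+ e g) * (h / x ^+ e h) \in B by exact: gpredM.
  have K : chi q.1 (g * h / x ^+ e (g * h)) =
      (chi q.1 (g / x ^+ e g)%g + chi q.1 (h / x ^+ e h)%g + y q.1 *+ (r * c))%R.
    rewrite -E gh mulnC expgnA chiM //; last exact: gpredXn.
    by rewrite chiM // chiX // -yP -mulrnA.
  rewrite /psi K [in RHS]addrACA -mulrnDr eE mulrnDr addrA; congr (_ + _ + _)%R.
  by rewrite (mulnC c) mulrnDl -[(z *+ _ *+ _)%R]mulrnA mulnCA (mulrnA z) zr mul0rn addr0.
- move=> [i d] [j d'] E.
  have <- : i = j by apply: chi_inj => g gB; rewrite -(psiB (i, d)) // E ?BB' // psiB.
  congr pair; apply: val_inj => /=.
  have [r1|r1] := leqP r 1%N.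
    have d0 (u : 'I_r) : u = 0 :> nat by have := leq_trans (ltn_ord u) r1; case: (nat_of_ord u).
    by rewrite !d0.
  have ex : e x = 1%N.
    have [ex xe] := eP _ xB'; apply: (e_uniq x) => //; by rewrite mulgV gpred1.
  have := E _ xB'; rewrite /psi /= ex expg1 mulgV !chi1 !add0r !mulr1n.
  have <- : i = j by apply: chi_inj => g gB; rewrite -(psiB (i, d)) // E ?BB' // psiB.
  move=> /addrI; rewrite /z -!mulrnA => /(congr1 val).
  rewrite ![val _]val_Zp_nat // !modn_small; last 2 first.
  - by rewrite -[X in _ < X](divnK rk) ltn_pmul2l.
  - by rewrite -[X in _ < X](divnK rk) ltn_pmul2l.
  by move/eqP; rewrite eqn_pmul2l // => /eqP.
Qed.

Lemma abelian_characters (s : seq A) : (forall a, a \in s) ->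
  exists (I : finType) (chi : I -> A -> 'Z_k) (t : seq A),
    [/\ size t = #|I|, forall a, a \in t,
        forall i a b, chi i (a * b) = (chi i a + chi i b)%R & injective chi].
Proof.
move=> sA.
have [B [sB [I [chi [t [tI Bt chiM chi_inj]]]]]] :
    exists B, {subset s <= B} /\ many_characters B.
  elim: s {sA} => [|x s [B [sB mB]]].
    by have [B mB] := trivial_characters; exists B.
  have [B' [BB' xB' mB']] := extend_characters x mB; exists B'; split=> // a.
  by rewrite inE => /orP[/eqP->//|/sB/BB'].
have BA a : a \in B by exact: sB.
exists I, chi, t; split=> // [a|i a b|i j E]; [exact: Bt | exact: chiM |].
by apply: chi_inj => a _; rewrite E.
Qed.
End Characters.

Lemma finite_group_exponent (A : groupType) (s : seq A) : (forall a, a \in s) ->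
  exists2 k, 1 < k & forall a : A, a ^+ k = 1.
Proof.
(* The factor 2 makes the exponent exceed 1, so that ['Z_k] really is the ring of integers modulo
   [k]. *)
move=> sA; exists ((size s)`! * 2)%N => [|a].
  by have := fact_gt0 (size s); lia.
pose u := [seq a ^+ i | i <- iota 0 (size s).+1].
have : ~~ uniq u.
  apply/negP => /uniq_leq_size/(_ (fun x _ => sA x)).
  by rewrite size_map size_iota ltnn.
case/(uniqPn 1) => i [j [ij]]; rewrite size_map size_iota => js.
have is' := ltn_trans ij js.
rewrite !(nth_map 0) ?size_iota // !nth_iota // !add0n => E.
have aij : a ^+ (j - i) = 1 by rewrite expgnFr ?(ltnW ij) // E mulgV.
have /dvdnP[m ->] : j - i %| (size s)`! * 2.
  by rewrite dvdn_mulr // dvdn_fact // subn_gt0 ij (leq_trans (leq_subr _ _)).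
by rewrite mulnC expgnA aij expg1n.
Qed.

(** * Quotients and rank *)

Section QuotientMap.
Variables (G : groupType) (K N : groupClosed G).
Hypothesis NK : is_normal K N.

Lemma normal_normalises x : x \in K -> normalises N x.
Proof.
move=> xK y; apply/idP/idP => [yx|yN]; last exact: NK.2.
by rewrite -(conjgK x y); apply: NK.2 => //; rewrite gpredV.
Qed.

Lemma quotient_map : exists cl : G -> quotient_group K N,
  [/\ {in K &, {morph cl : x y / x * y}}, forall x, x \in K -> (cl x = 1 <-> x \in N) &
      forall q, exists2 x, x \in K & q = cl x].
Proof.
have /choice [cl clP] : forall x, exists q : quotient_group K N,
    x \in K -> val q = left_coset x N.
  move=> x; have [xK|] := boolP (x \in K); last by exists 1.
  have xq : `[< is_quotient_elt K N (left_coset x N) >].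
    by apply/asboolP; exists x; split=> //; exact: normal_normalises.
  by exists (QuotientGroup xq).
exists cl; split.
- move=> x y xK yK; apply: val_inj; rewrite clP ?gpredM //= !clP //.
  by rewrite coset_mulE //; exact: normal_normalises.
- move=> x xK; rewrite -[x in X in _ <-> X]invgK gpredV -[x^-1]mulg1.
  split=> [E|/left_coset_eq E]; last by apply: val_inj; rewrite clP.
  by apply/left_coset_eq; rewrite -clP // E.
- move=> q; have /asboolP[x [xK _ qE]] := valP q.
  by exists x => //; apply: val_inj; rewrite clP.
Qed.

Lemma quotient_transversal : finite_set (left_cosets K N) ->
  exists s : seq (quotient_group K N),
    [/\ forall q, q \in s, uniq s & size s = subgroup_index K N].
Proof.
move=> fin; have [s [[sK cov inj] us sn]] := transversal_uniqP fin.
have [cl [clM cl1 cl_surj]] := quotient_map.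
have clE x y : x \in K -> y \in K -> x^-1 * y \in N -> cl x = cl y.
  move=> xK yK xyN; have zK : x^-1 * y \in K by apply: NK.1.
  have -> : cl y = cl (x * (x^-1 * y)) by rewrite mulVKg.
  by rewrite clM // ((cl1 _ zK).2 xyN) mulg1.
have cl_inj : {in s &, injective cl}.
  move=> x y /[dup] xs /sK xK /[dup] ys /sK yK E; apply: inj => //.
  have xVK : x^-1 \in K by rewrite gpredV.
  apply/cl1; first exact: gpredM.
  by rewrite clM // -E -clM // mulVg; apply/cl1; rewrite ?gpred1.
exists (map cl s); split; last by rewrite size_map.
  move=> q; have [x xK ->] := cl_surj q; have [y ys yxN] := cov x xK.
  by apply/mapP; exists y => //; apply/esym/clE => //; exact: sK.
by rewrite map_inj_in_uniq.
Qed.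

End QuotientMap.

Section Rank.
Variable G : groupType.

Lemma generatesP (s : seq G) : generates s <->
  forall H : groupClosed G, {subset s <= H} -> forall x, x \in H.
Proof.
split=> [gs H sH x|gs].
  have : [set: G] x by []. 
  by rewrite -gs; apply => y /=; exact: sH.
by apply/seteqP; split=> // x _ H /= sH; apply: gs => y; exact: sH.
Qed.

Lemma is_rank_exists (s : seq G) : generates s -> exists2 n, is_rank G n & n <= size s.
Proof.
move=> gs; have ex : exists n, `[< exists2 t : seq G, generates t & size t = n >].
  by exists (size s); apply/asboolP; exists s.
exists (ex_minn ex); case: ex_minnP => n /asboolP nP nmin.
  by split=> // t gt; apply: nmin; apply/asboolP; exists t.
by apply: nmin; apply/asboolP; exists s.
Qed.

Lemma is_rank_uniq m n : is_rank G m -> is_rank G n -> m = n.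
Proof.
move=> [[s gs sm] mmin] [[t gt tn] nmin]; apply/eqP; rewrite eqn_leq.
by rewrite -{1}tn -{2}sm mmin ?nmin.
Qed.

Lemma group_rankP (s : seq G) : generates s ->
  group_rank G <= size s /\ exists2 t : seq G, generates t & size t = group_rank G.
Proof.
move=> /is_rank_exists [n nr ns].
have -> : group_rank G = n.
  by rewrite /group_rank; case: xgetP => [m _ /is_rank_uniq|/(_ n)//]; apply.
by split=> //; case: nr.
Qed.

End Rank.

(** * A small integral cocycle and its cut *)

Lemma small_Zp_int_eq0 k (x : int) : 1 < k -> (`|x| < Posz k)%R ->
  (x%:~R = 0 :> 'Z_k)%R -> x = 0%R.
Proof.
move=> k1 xk x0.
have small m : m < k -> (m%:R = 0 :> 'Z_k)%R -> m = 0.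
  by move=> mk /(congr1 val); rewrite [val _]val_Zp_nat //= modn_small.
case: x xk x0 => m mk m0; first by rewrite (small m).
have : (m.+1%:R = 0 :> 'Z_k)%R by apply/eqP; rewrite -oppr_eq0; apply/eqP.
by move/small => H; have : m.+1 = 0 by apply: H; move: mk; rewrite NegzE normrN; lia.
Qed.

Section SmallCocycle.
Variables (G : groupType) (n : nat) (gen : 'I_n -> G) (rels : seq (seq ('I_n * bool))).
Hypotheses (genG : generating gen) (rels1 : forall r, r \in rels -> weval gen r = 1).
Hypothesis sc : simply_connected gen rels.

Section Integration.
Variables (k q : nat) (psi : G -> 'Z_k) (w : 'I_n -> G -> int).
Hypotheses (k_gt1 : 1 < k) (q_gt0 : 0 < q).
Hypothesis relsq : forall r, r \in rels -> size r <= q.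
Hypothesis w_small : forall a g, (`|w a g| * Posz q < Posz k)%R.
Hypothesis psiM : forall a g, psi (gen a * g) = ((w a g)%:~R + psi g)%R.

(* The holonomy of w is divisible by k because w lifts the coboundary of psi,
   and it is smaller than k because relators are short. *)
Lemma integrate_small_cocycle : exists eta : G -> int,
  [/\ eta 1 = 0%R, forall a g, eta (gen a * g) = (w a g + eta g)%R &
      forall g, ((eta g)%:~R = psi g - psi 1%g)%R].
Proof.
pose A := Algebra.to_multiplicative int.
(* Each edge contributes to [x] an integer with [|w| * q <= k - 1]. For a relator, of length at most
   [q], this leaves [|x| <= k - 1]. *)
have hol r g : exists x : int, [/\ holonomy gen (w : 'I_n -> G -> A) r g = x,
    (`|x| * Posz q <= Posz (size r) * (Posz k - 1))%R &
    psi (weval gen r * g) = (x%:~R + psi g)%R].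
  elim: r => [|[a s] r [h [hE hs hp]]].
    by exists 0%R; rewrite normr0 !mul0r /= mul1g add0r.
  rewrite [weval _ _]/= -mulgA.
  set v := (weval gen r * g) in hp *.
  exists ((if s then w a v else (- w a ((gen a)^-1 * v)%g)) + h)%R; split.
  - by rewrite /= hE; case: s.
  - set u := (if s then _ else _).
    have us : (`|u| * Posz q < Posz k)%R by rewrite /u; case: (s); rewrite ?normrN w_small.
    apply: (@le_trans _ _ ((`|u| + `|h|) * Posz q)%R); first by rewrite ler_wpM2r // ler_normD.
    by rewrite /= mulrDl -addn1 PoszD [leRHS]mulrDl mul1r [leRHS]addrC lerD //; lia.
  - rewrite (rmorphD (intmul 1)) -addrA -hp; case: s; rewrite /letter /= ?psiM //.
    by have := psiM a ((gen a)^-1 * v); rewrite mulVKg => ->; rewrite rmorphN addKr.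
have [eta [eta1 etaM]] : exists eta, is_potential gen (w : 'I_n -> G -> A) eta.
  apply: sc => r rr g.
  have rr' := In_mem rr.
  have [x [-> hs]] := hol r g; rewrite rels1 // mul1g => hp.
  apply: (@small_Zp_int_eq0 k) => //.
    have hq : (`|x| * Posz q <= (Posz k - 1) * Posz q)%R.
      apply: le_trans hs _; rewrite [leRHS]mulrC; apply: ler_wpM2r; first by lia.
      by rewrite lez_nat relsq.
    by rewrite ler_pM2r // in hq; lia.
  by apply/eqP; have /eqP := hp; rewrite -subr_eq subrr eq_sym.
exists eta; split=> //.
apply: (generating_ind genG) => [|a g].
  by rewrite eta1 subrr.
rewrite etaM psiM intrD -addrA.
by split=> [->|/addrI].
Qed.

End Integration.

(** By pigeonhole two characters of [H / N] differ by less than [k / q] on every edge of the coset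
    graph. Their integer difference is the small cocycle, and its integral [eta] reduces modulo [k]
    to the difference of the characters on [H]. *)
Lemma small_cocycle (H N : groupClosed G) q : is_normal H N ->
  has_finite_index H -> finite_set (left_cosets H N) ->
  is_abelian (quotient_group H N) ->
  0 < q -> (forall r, r \in rels -> size r <= q) ->
  q ^ (n * subgroup_index predT H) < subgroup_index H N ->
  exists (k : nat) (eta : G -> int),
  [/\ 0 < k, eta 1 = 0%R, forall g h, h \in H -> eta (g * h) = (eta g + eta h)%R,
      forall a g, (`|eta (gen a * g)%g - eta g| * Posz q < Posz k)%R &
      (forall g, g \in N -> exists d, eta g = (d * Posz k)%R) /\
      exists2 h, h \in H & eta h <> 0%R].
Proof.
move=> NH finH finN abQ q_gt0 relsq big.
have [cl [clM cl1 cl_surj]] := quotient_map NH.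
have [Q [QA uQ Qn]] := quotient_transversal NH finN.
have [k k_gt1 expQ] := finite_group_exponent QA.
have [I [chi [t [tI tQ chiM chi_inj]]]] := abelian_characters abQ k_gt1 expQ QA.
have chi1 i : chi i 1 = 0%R.
  by have := chiM i 1 1; rewrite mulg1 => /eqP; rewrite -subr_eq subrr => /eqP.
have [tau [tau1 tauH tau_inv]] := coset_section H.
have [v [[_ v_cov _] _ vn]] := transversal_uniqP finH.
(* The Schreier label in [H] of an edge of the coset graph; it depends only on the coset of [g]. *)
pose e a g := (tau (gen a * g))^-1 * (gen a * tau g).
have eH a g : e a g \in H.
  have -> : e a g = ((tau (gen a * g))^-1 * (gen a * g)) * ((tau g)^-1 * g)^-1.
    by rewrite /e invgM invgK -!mulgA mulVKg.
  by apply: gpredM; rewrite ?gpredV tauH.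
have e_inv a g h : h \in H -> e a (g * h) = e a g.
  by move=> hH; rewrite /e (mulgA _ g) (tau_inv (gen a * g)) // (tau_inv g).
have eM a g : (tau (gen a * g))^-1 * (gen a * g) = e a g * ((tau g)^-1 * g).
  by rewrite /e -!mulgA mulVKg.
pose c i a g : 'Z_k := chi i (cl (e a g)).
have c_lt i a g : c i a g < k by rewrite -[X in _ < X](Zp_cast k_gt1) ltn_ord.
have box_lt i a g : c i a g * q %/ k < q.
  by rewrite ltn_divLR ?(ltnW k_gt1) // mulnC ltn_pmul2l.
(* For each of the [n [G : H]] edges, the pattern of a character records which of [q] intervals of
   residues contains its value. There are more characters than patterns. *)
pose box i := [ffun p : 'I_n * 'I_(subgroup_index predT H) =>
  Ordinal (box_lt i p.1 (nth 1 v p.2))].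
have [i [j [ij bij]]] : exists i j, i <> j /\ box i = box j.
  apply: contrapT => inj; have /leq_card : injective box.
    by move=> i j bij; apply: contrapT => ij; apply: inj; exists i, j.
  apply/negP; rewrite -ltnNge card_ffun card_prod !card_ord.
  apply: leq_trans big _; rewrite -tI -Qn.
  by apply: uniq_leq_size => // x _; exact: tQ.
have cij a g : c i a g * q %/ k = c j a g * q %/ k.
  have [x xv xg] := v_cov g isT.
  have -> : g = x * (x^-1 * g) by rewrite mulVKg.
  rewrite /c !e_inv //; have ixP : index x v < subgroup_index predT H by rewrite -vn index_mem.
  have := congr1 (fun f : {ffun _ -> 'I_q} => val (f (a, Ordinal ixP))) bij; rewrite !ffunE /= nth_index //.
pose w a g : int := (Posz (c i a g) - Posz (c j a g))%R.
have w_small a g : (`|w a g| * Posz q < Posz k)%R.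
  rewrite /w; have := cij a g; move: (nat_of_ord (c i a g)) (nat_of_ord (c j a g)) => x y E.
  have := divn_eq (x * q)%N k; have := ltn_pmod (x * q)%N (ltnW k_gt1).
  have := divn_eq (y * q)%N k; have := ltn_pmod (y * q)%N (ltnW k_gt1).
  by rewrite E; nia.
pose psi g := (chi i (cl ((tau g)^-1 * g)%g) - chi j (cl ((tau g)^-1 * g)%g))%R.
have psiM a g : psi (gen a * g) = ((w a g)%:~R + psi g)%R.
  rewrite /psi eM clM ?tauH // !chiM /w intrB -!pmulrn !natr_Zp /c.
  by rewrite opprD addrACA.
have psi1 : psi 1 = 0%R.
  have H1 : 1 \in H by exact: gpred1.
  by rewrite /psi tau1 invg1 mulg1 (cl1 _ H1).2 ?gpred1 // !chi1 subrr.
have psiE g : g \in H -> psi g = (chi i (cl g) - chi j (cl g))%R.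
  by move=> gH; rewrite /psi -(mul1g g) tau_inv // tau1 invg1 !mul1g.
have [eta [eta1 etaM eta_psi]] := integrate_small_cocycle k_gt1 q_gt0 relsq w_small psiM.
exists k, eta; split=> //; first exact: ltnW.
- move=> g h hH; move: g; apply: (generating_ind genG) => [|a g].
    by rewrite mul1g eta1 add0r.
  rewrite -mulgA !etaM (_ : w a (g * h) = w a g); last by rewrite /w /c e_inv.
  rewrite -(addrA (w a g)).
  by split=> [->|/addrI].
- by move=> a g; rewrite etaM addrK.
split.
  move=> g gN; exists (eta g %/ Posz k)%Z.
  have E := divz_eq (eta g) (Posz k).
  rewrite [LHS]E (@small_Zp_int_eq0 k (eta g %% Posz k)%Z) ?addr0 //.
    by have := ltz_pmod (eta g) (ltnW k_gt1 : (0 < Posz k)%R);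
       have := modz_ge0 (eta g) (lt0r_neq0 (ltnW k_gt1 : (0 < Posz k)%R)); lia.
  have gH := NH.1 _ gN.
  have := eta_psi g; rewrite psi1 psiE // (cl1 _ gH).2 // !chi1 subrr subr0.
  rewrite [in X in X -> _]E intrD intrM -[((Posz k)%:~R)%R]pmulrn pchar_Zp // mulr0 add0r.
  by [].
(* If [eta] vanished on [H], the two characters would agree modulo [k] everywhere. *)
apply: contrapT => H0; apply: ij; apply/chi_inj/funext => x.
have [h hH ->] := cl_surj x.
have : eta h = 0%R by apply: contrapT => h0; apply: H0; exists h.
move=> h0; have := eta_psi h; rewrite h0 psi1 subr0 psiE // => /esym/eqP.
by rewrite subr_eq0 => /eqP.
Qed.

End SmallCocycle.

(** * Cutting an integer function at a level *)

Section Levels.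
Variable k : nat.
Hypothesis k_gt0 : 0 < k.
Local Open Scope ring_scope.

Definition level (x : int) : int := (x %/ Posz k)%Z.

Lemma k_neq0 : Posz k != 0. Proof. by rewrite eqz_nat -lt0n. Qed.

Lemma levelD (d x : int) : level (d * Posz k + x) = d + level x.
Proof. by rewrite /level divzMDl // k_neq0. Qed.

Lemma level_small (x : int) : 0 <= x -> x < Posz k -> level x = 0.
Proof. by move=> x0 xk; rewrite /level divz_small // ?x0 //; apply/andP. Qed.

Lemma levelP (x : int) : exists r : int, [/\ 0 <= r, r < Posz k & x = level x * Posz k + r].
Proof.
exists (x %% Posz k)%Z; split; last exact: divz_eq.
  exact: modz_ge0 k_neq0.
exact: ltz_pmod.
Qed.

Lemma level_step (z : int) : level z <> level (z + 1) -> exists d, z + 1 = d * Posz k.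
Proof.
have [r [r0 rk E]] := levelP (z + 1) => ne; exists (level (z + 1)).
have [r_eq|r_ne] := eqVneq r 0; first by rewrite [LHS]E r_eq addr0.
case: ne; have zE : z = level (z + 1) * Posz k + (r - 1) by lia.
have r_gt0 : 0 < r by rewrite lt0r r_ne.
by rewrite [in LHS]zE levelD (@level_small (r - 1)) ?addr0 //; lia.
Qed.

(** By induction on the distance: a unit step crosses a multiple of [k] for at most one shift among
    [k] consecutive ones. *)
Lemma level_change_count (x y : int) :
  (#|[pred t : 'I_k | level (x + Posz t) != level (y + Posz t)]| <= `|x - y|)%N.
Proof.
wlog xy : x y / x <= y.
  move=> W; case: (lerP x y) => [|/ltW] /W //; rewrite distnC; apply: leq_trans.
  by apply: subset_leq_card; apply/fintype.subsetP => t; rewrite !inE eq_sym.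
have [d ->] : exists d : nat, y = x + Posz d by exists `|y - x|%N; lia.
have -> : `|(x - (x + Posz d))%R|%N = d by lia.
elim: d {y xy} => [|d IH].
  by rewrite leqn0; apply/eqP/eq_card0 => t; rewrite !inE addr0 eqxx.
set A := [pred t : 'I_k | _]; pose z := x + Posz d.
pose B := [pred t : 'I_k | level (x + Posz t) != level (z + Posz t)].
pose C := [pred t : 'I_k | level (z + Posz t) != level (z + Posz t + 1)].
have sub : A \subset [predU B & C].
  apply/fintype.subsetP => t; rewrite !inE (_ : x + Posz d.+1 + Posz t = z + Posz t + 1); last by rewrite /z; lia.
  by have [<-|] := eqVneq (level (x + Posz t)) (level (z + Posz t)).
apply: leq_trans (subset_leq_card sub) _; apply: leq_trans (_ : #|B| + #|C| <= _)%N.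
  by rewrite -cardUI leq_addr.
rewrite -addn1 leq_add //; apply/card_le1_eqP => s t; rewrite !inE => /eqP/level_step[d1 E1] /eqP/level_step[d2 E2].
apply: val_inj; have := ltn_ord s; have := ltn_ord t; move: E1 E2.
move: (z) => u; rewrite /=; move: (nat_of_ord s) (nat_of_ord t) => a b E1 E2 bk ak.
have E : (d1 - d2) * Posz k = Posz a - Posz b by lia.
have : d1 - d2 = 0 by nia.
by move=> d0; rewrite d0 in E; lia.
Qed.

End Levels.

Section Cut.
Variables (G : groupType) (n : nat) (gen : 'I_n -> G) (N : groupClosed G).
Hypothesis finN : has_finite_index N.

(** The function [phi] is the integer part of [(eta + t) / k]. An edge is cut for fewer than [k / q]
    of the [k] thresholds [t] (or for none), so averaging over [t] finds one that cuts at most [n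
    [G : N] / q] edges modulo [N]. *)
Lemma cut (k q : nat) (eta : G -> int) : 0 < k -> eta 1 = 0%R ->
  (forall g h, h \in N -> eta (g * h) = (eta g + eta h)%R) ->
  (forall a g, (`|eta (gen a * g)%g - eta g| * Posz q < Posz k)%R) ->
  (forall g, g \in N -> exists d, eta g = (d * Posz k)%R) ->
  exists (phi : G -> int) (l : seq G),
    [/\ forall g h, h \in N -> phi (g * h) = (phi g + phi h)%R,
        forall h, h \in N -> eta h = (phi h * Posz k)%R,
        (size l * q <= n * subgroup_index predT N)%N &
        forall a g, phi (gen a * g) <> phi g -> exists2 x, x \in l & x^-1 * g \in N].
Proof.
move=> k0 eta1 etaM eta_small etaN.
have [v [[_ v_cov _] _ vn]] := transversal_uniqP finN.
pose phi t g := level k (eta g + Posz t)%R.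
pose jump t a g := phi t (gen a * g) != phi t g.
pose l t := [seq x <- v | [exists a, jump t a x]].
have phiN t g h : t < k -> h \in N -> phi t (g * h) = (phi t g + phi t h)%R /\ eta h = (phi t h * Posz k)%R.
  move=> tk hN; have [d dE] := etaN h hN.
  have -> : phi t h = d by rewrite /phi dE levelD // level_small ?addr0.
  rewrite /phi etaM // dE (_ : _ + Posz t = d * Posz k + (eta g + Posz t))%R; last by lia.
  by rewrite levelD // addrC.
have [t [tk lt]] : exists t, t < k /\ size (l t) * q <= n * subgroup_index predT N.
  apply: contrapT => H.
  have big (t : 'I_k) : n * size v < size (l t) * q.
    by rewrite vn ltnNge; apply/negP => le; apply: H; exists t.
  have : \sum_(t < k) (n * size v).+1 <= \sum_(t < k) size (l t) * q by apply: leq_sum.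
  rewrite sum_nat_const card_ord -big_distrl /=; apply/negP; rewrite -ltnNge.
  have size_l (t : 'I_k) : size (l t) <= \sum_(x <- v) \sum_(a < n) jump t a x.
    rewrite size_filter -sum1_count big_mkcond; apply: leq_sum => x _.
    by case: existsP => // -[a ja]; rewrite (bigD1 a) //= ja.
  have jumps a x : (\sum_(t < k) jump t a x) * q <= k.
    have -> : \sum_(t < k) jump t a x = #|[pred t : 'I_k | jump t a x]|.
      by rewrite -sum1_card [RHS]big_mkcond.
    have := level_change_count k0 (eta (gen a * x)) (eta x) => le.
    apply: leq_trans (leq_mul le (leqnn q)) _.
    have := eta_small a x; lia.
  apply: (@leq_ltn_trans ((\sum_(x <- v) \sum_(a < n) \sum_(t < k) jump t a x) * q)).
    rewrite leq_mul2r; apply/orP; right.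
    rewrite (eq_bigr (fun x => \sum_(t < k) \sum_(a < n) jump t a x)); last by move=> x _; exact: exchange_big.
    by rewrite exchange_big; apply: leq_sum => t _; exact: size_l.
  rewrite mulnS big_distrl /=; apply: (@leq_ltn_trans (\sum_(x <- v) n * k)).
    apply: leq_sum => x _; rewrite big_distrl /=.
    by apply: leq_trans (leq_sum _ (fun a _ => jumps a x)) _; rewrite sum_nat_const card_ord.
  by rewrite big_const_seq count_predT iter_addn_0; nia.
exists (phi t), (l t); split=> //.
- by move=> g h hN; case: (phiN t g h tk hN).
- by move=> h hN; case: (phiN t 1 h tk hN).
- move=> a g /eqP jg; have [x xv xg] := v_cov g isT; exists x => //.
  rewrite mem_filter xv andbT; apply/existsP; exists a; rewrite /jump.
  have gE : g = x * (x^-1 * g) by rewrite mulVKg.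
  move: jg; rewrite gE mulgA; have [-> _] := phiN t (gen a * x) _ tk xg; have [-> _] := phiN t x _ tk xg.
  by apply: contraNneq => ->.
Qed.

End Cut.

(** * Loops in the complement of the cut *)

Section FiniteIndex.
Variable G : groupType.
Implicit Types N M : groupClosed G.

Lemma finite_index_sup M N : {subset M <= N} -> has_finite_index M -> has_finite_index N.
Proof.
move=> MN finM; have [s [[_ cov _] _ _]] := transversal_uniqP finM.
have [] // := @covering_index _ predT N s.
by move=> x xG; have [y ys yx] := cov x xG; exists y => //; exact: MN.
Qed.

Lemma finite_index_power N h : has_finite_index N -> exists2 m, 0 < m & h ^+ m \in N.
Proof.
move=> finN; have [s [[_ cov _] _ _]] := transversal_uniqP finN.
have /choice [r rP] : forall x, exists y, y \in s /\ y^-1 * x \in N.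
  by move=> x; have [y ? ?] := cov x isT; exists y.
pose u := [seq r (h ^+ i) | i <- iota 0 (size s).+1].
have : ~~ uniq u.
  have us : {subset u <= s} by move=> _ /mapP[i _ ->]; case: (rP (h ^+ i)).
  by apply/negP => /uniq_leq_size/(_ us); rewrite size_map size_iota ltnn.
case/(uniqPn 1) => i [j [ij]]; rewrite size_map size_iota => js.
have is' := ltn_trans ij js.
rewrite !(nth_map 0) ?size_iota // !nth_iota // !add0n => E.
exists (j - i); first by rewrite subn_gt0.
have [_ iN] := rP (h ^+ i); have [_ jN] := rP (h ^+ j); rewrite -E in jN.
have -> : h ^+ (j - i) = (h ^+ j / h ^+ i) by rewrite expgnFr ?(ltnW ij).
have -> : h ^+ j / h ^+ i = h ^- i * h ^+ j.
  by apply: commuteV; apply: commute_sym; apply: commuteX2; apply: commute_refl.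
have -> : h ^- i * h ^+ j = ((r (h ^+ i))^-1 * h ^+ i)^-1 * ((r (h ^+ i))^-1 * h ^+ j).
  by rewrite invgM invgK -!mulgA mulVKg.
by apply: gpredM => //; rewrite gpredV.
Qed.

End FiniteIndex.

Lemma edges_translate (X : Type) (G : groupType) (gen : X -> G) W g :
  edges gen W g = [seq (e.1, e.2 * g) | e <- edges gen W 1].
Proof.
elim: W => //= l W ->; rewrite mulg1; congr ((_, _) :: _).
by case: l.2; rewrite ?mulgA.
Qed.

Section Cells.
Variables (G : groupType) (n : nat) (gen : 'I_n -> G) (rels : seq (seq ('I_n * bool))).

(** The quotients of origins of two edges of one relator loop. They do not depend on the base point,
    as loops are translated on the right; they reach all edges of a cell from any one of them. *)
Definition cell_ratios : seq G :=
  flatten [seq [seq e.2 / e'.2 | e <- edges gen r 1, e' <- edges gen r 1] | r <- rels].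

Lemma cell_ratiosP r g a h a' h' : r \in rels ->
  (a, h) \in edges gen r g -> (a', h') \in edges gen r g ->
  exists2 y, y \in cell_ratios & h = y * h'.
Proof.
move=> rr; rewrite !(edges_translate gen r g) => /mapP[[b y] ye [_ ->]] /mapP[[b' y'] ye' [_ ->]].
exists (y / y'); last by rewrite -!mulgA mulKg.
apply/flattenP; exists [seq e.2 / e'.2 | e <- edges gen r 1, e' <- edges gen r 1].
  by apply/mapP; exists r.
by apply/allpairsP; exists ((b, y), (b', y')).
Qed.

End Cells.

Section FlatConnection.
Variables (G : groupType) (n : nat) (gen : 'I_n -> G).
Hypothesis genG : generating gen.
Variables (N M : groupClosed G) (phi : G -> int) (l : seq G).
Hypothesis abQ : is_abelian (quotient_group N M).
Hypothesis phiM : forall g h, h \in N -> phi (g * h) = (phi g + phi h)%R.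
Hypothesis phi_cut : forall a g, phi (gen a * g) <> phi g ->
  exists2 x, x \in l & x^-1 * g \in N.

(* Joined by a path of the Cayley graph along which phi is constant. *)
Definition level_connected x y := forall P : G -> Prop,
  (forall a g, phi (gen a * g) = phi g -> P g <-> P (gen a * g)) -> P x -> P y.

Lemma level_connected_refl x : level_connected x x.
Proof. by []. Qed.

Lemma level_connected_trans x y z :
  level_connected x y -> level_connected y z -> level_connected x z.
Proof. by move=> xy yz P Pc /(xy P Pc); exact: yz. Qed.

Lemma level_connected_sym x y : level_connected x y -> level_connected y x.
Proof.
move=> xy P Pc Py; apply: contrapT => nPx; apply: (xy (fun g => ~ P g)) Py => // a g E.
by have := Pc a g E; tauto.
Qed.

Lemma level_connected_mul x y h : h \in N ->
  level_connected x y -> level_connected (x * h) (y * h).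
Proof.
move=> hN xy P Pc; apply: (xy (fun g => P (g * h))) => a g E.
by rewrite -mulgA; apply: Pc; rewrite mulgA (phiM (_ * g)) // (phiM g) // E.
Qed.

Lemma level_connected_step a g : phi (gen a * g) = phi g -> level_connected g (gen a * g).
Proof. by move=> E P Pc Pg; apply/(Pc a g E). Qed.

Variable cl : G -> quotient_group N M.
Hypotheses (clM : {in N &, {morph cl : x y / x * y}})
  (cl_surj : forall q, exists2 x, x \in N & q = cl x).

(* If all loops at constant level die in the quotient by K then the quotient
   map extends to a function kappa that is constant on level components, so
   that the quotient is generated by the changes of kappa across the cut. *)
Lemma exists_level_loop (E : seq (quotient_group N M)) (K : groupClosed (quotient_group N M)) :
  (forall H : groupClosed (quotient_group N M), {subset E <= H} -> {subset K <= H}) ->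
  size E + n * size l < group_rank (quotient_group N M) ->
  exists x d, [/\ d \in N, level_connected x (x * d) & cl d \notin K].
Proof.
move=> KE rk; apply: contrapT => noloop.
have loopK x d : d \in N -> level_connected x (x * d) -> cl d \in K.
  by move=> dN xd; apply: contrapT => /negP dK; apply: noloop; exists x, d.
(* Classes of [R] are the level components up to translation by [N]. With [r g] a chosen base point,
   [c g] is a translation carrying it into the component of [g]; it is unique modulo [K] after
   applying [cl], since loops die in [K]. *)
pose R g g' := exists2 d, d \in N & level_connected g (g' * d).
pose r g := xget 1 [set g' | R g g'].
have /choice [c cP] : forall g, exists d, d \in N /\ level_connected g (r g * d).
  move=> g; rewrite /r; case: xgetP => [g' _ [d dN gd]|/(_ g) []]; first by exists d.
  by exists 1; rewrite ?gpred1 ?mulg1.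
have rE g g' d : d \in N -> level_connected g (g' * d) -> r g = r g'.
  move=> dN gd; congr xget; apply/seteqP; split=> h [e eN he].
    exists (e * d^-1); first by rewrite gpredM ?gpredV.
    apply: level_connected_trans (_ : level_connected _ (g * d^-1)) _.
      apply: level_connected_sym; rewrite -[g'](mulgK d); apply: level_connected_mul => //.
      by rewrite gpredV.
    by rewrite mulgA; apply: level_connected_mul; rewrite ?gpredV.
  exists (e * d); first exact: gpredM.
  apply: level_connected_trans gd _; rewrite mulgA; exact: level_connected_mul.
have cN g : c g \in N by case: (cP g).
pose b g := cl (c g).
have clV d : d \in N -> cl d^-1 = (cl d)^-1.
  move=> dN; apply: (@mulgI _ (cl d)); rewrite -clM ?gpredV // !mulgV.
  have N1 : 1 \in N by exact: gpred1.
  by apply: (@mulgI _ (cl 1)); rewrite -clM // !mulg1.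
have bK g g' d : d \in N -> level_connected g' (g * d) -> (b g')^-1 * (b g * cl d) \in K.
  move=> dN gd; have rgg' := rE _ _ _ dN gd.
  rewrite -clV // -!clM ?gpredV ?gpredM //.
  apply: (loopK (r g' * c g')); first by rewrite !gpredM ?gpredV.
  apply: level_connected_trans (level_connected_sym (proj2 (cP g'))) _.
  apply: level_connected_trans gd _.
  rewrite -mulgA mulVKg rgg' mulgA; apply: level_connected_mul => //.
  by case: (cP g).
(* The jumps of [b] over the cut. Together with [E] they would generate the quotient, with fewer
   elements than its rank. *)
pose F := [seq (b x)^-1 * b (gen a * x) | a <- enum 'I_n, x <- l].
suff genEF : generates (E ++ F).
  have [+ _] := group_rankP genEF; rewrite leqNgt; apply/negP/negPn.
  by rewrite size_cat size_allpairs size_enum_ord.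
apply/generatesP => H EFH.
have KH : {subset K <= H} by apply: KE => u uE; apply: EFH; rewrite mem_cat uE.
pose eqH u v := u^-1 * v \in H.
have eqHC u v : eqH u v -> eqH v u.
  by rewrite /eqH -[in X in _ -> X]gpredV invgM invgK.
have eqHT u v z : eqH u v -> eqH v z -> eqH u z.
  by move=> uv vz; rewrite /eqH -(mulVKg v z) mulgA; exact: gpredM.
have eqHM u v z : eqH u v -> eqH (u * z) (v * z).
  by rewrite /eqH => uv; rewrite (abQ u) (abQ v) invgM -mulgA mulKg.
have bH g g' d : d \in N -> level_connected g' (g * d) -> eqH (b g') (b g * cl d).
  by move=> dN gd; apply/KH/bK.
have step a g : eqH (b g) (b (gen a * g)).
  have [E0|E0] := pselect (phi (gen a * g) = phi g).
    have N1 : 1 \in N by exact: gpred1.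
    have cl1 : cl 1 = 1 by apply: (@mulgI _ (cl 1)); rewrite -clM // !mulg1.
    have := bH (gen a * g) g 1 N1; rewrite !mulg1 cl1 mulg1; apply.
    exact: level_connected_step.
  have [x xl xg] := phi_cut E0.
  have -> : g = x * (x^-1 * g) by rewrite mulVKg.
  move: (x^-1 * g) xg => d dN.
  have bd y : eqH (b (y * d)) (b y * cl d) by apply: bH => //; exact: level_connected_refl.
  apply: (eqHT _ _ _ (bd x)).
  rewrite mulgA; apply: (eqHT _ _ _ _ (eqHC _ _ (bd _))).
  apply: (eqHM (b x) (b (gen a * x)) (cl d)); apply: EFH; rewrite mem_cat; apply/orP; right.
  by apply/allpairsP; exists (a, x); rewrite mem_enum.
have b1 : forall g, eqH (b 1) (b g).
  apply: (generating_ind genG) => [|a g]; first by rewrite /eqH mulVg gpred1.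
  by split=> E1; apply: (eqHT _ _ _ E1); [|apply: eqHC]; exact: step.
move=> u; have [d dN ->] := cl_surj u.
have d1 : level_connected d (1 * d) by rewrite mul1g.
by have := eqHT _ _ _ (b1 d) (bH 1 d d dN d1); rewrite /eqH mulKg.
Qed.

End FlatConnection.

(** * From the series to a free quotient *)

Lemma mult_zpow (G H : groupType) (f : {multiplicative G -> H}) x d :
  f (zpow x d) = zpow (f x) d.
Proof.
elim/int_rec: d => [|m IH|m IH]; first exact: mult1.
  by rewrite -addn1 PoszD addrC !zpowS gmulfM IH.
by rewrite -addn1 PoszD opprD !zpowB1 gmulfM multV IH.
Qed.

Definition maps_onto_nonabelian_free (G : groupType) (H : groupClosed G) :=
  exists F : groupType, [/\ is_free F, ~ is_abelian F &
    exists f : G -> F, {in H &, {morph f : x y / x * y}} /\ f @` [set` H] = [set: F]].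

Section FreeQuotient.
Variables (G : groupType) (n : nat) (gen : 'I_n -> G) (rels : seq (seq ('I_n * bool))).
Hypotheses (genG : generating gen) (rels1 : forall r, r \in rels -> weval gen r = 1).
Hypothesis sc : simply_connected gen rels.
Variables (N K : groupClosed G) (phi : G -> int).
Hypothesis NK : is_normal N K.
Hypothesis phiM : forall g h, h \in N -> phi (g * h) = (phi g + phi h)%R.
Variable cl : G -> quotient_group N K.
Hypothesis cl1 : forall x, x \in N -> (cl x = 1 <-> x \in K).
Variable ups : G -> quotient_group N K.
Hypothesis upsM : forall g h, h \in N -> ups (g * h) = ups g * cl h.
(* A relator that crosses the cut stays in one fibre of ups. *)
Hypothesis ups_cell : forall r g a h b k, r \in rels ->
  (a, h) \in edges gen r g -> phi (gen a * h) <> phi h ->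
  (b, k) \in edges gen r g -> ups (gen b * k) = ups k.
Variables x d : G.
Hypotheses (dN : d \in N) (xd : level_connected gen phi x (x * d)) (dK : d \notin K).
Variable z : G.
Hypotheses (zK : z \in K) (phiz : phi z <> 0%R).

Let Q := quotient_group N K.
Let t : Q -> free_group Q := @free_gen Q.
Let w a g := zpow (t (ups g)) (phi (gen a * g) - phi g)%R.

Let KN : {subset K <= N}. Proof. by case: NK. Qed.

(** Along a relator that crosses the cut [ups] is constant, so [w] is there the coboundary of the
    power [phi] of one letter. Along any other relator [w] is trivial. *)
Lemma free_cut_potential : exists rho : G -> free_group Q, is_potential gen w rho.
Proof.
apply: sc => r rr g.
have {}rr := In_mem rr.
have [[a [h [ah jump]]]|flat] := pselect (exists a h, (a, h) \in edges gen r g /\ phi (gen a * h) <> phi h).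
  have := @holonomyE _ _ gen _ w r g (fun h => zpow (t (ups h)) (phi h)).
  rewrite rels1 // mul1g => E; apply: (@mulIg _ (zpow (t (ups g)) (phi g))).
  rewrite -E ?mul1g // => b k /In_mem bk.
  by rewrite (ups_cell rr ah jump bk) /w -zpowD subrK.
have := @holonomyE _ _ gen _ w r g (fun=> 1); rewrite mulg1 => <- // b k /In_mem bk.
have [E|E] := pselect (phi (gen b * k) = phi k); first by rewrite /w E subrr mulg1.
by case: flat; exists b, k.
Qed.

(** [rho] is a homomorphism on [K] with free image [J] and exponent sum [phi]. Were [J] abelian, the
    exponent sum would be injective on it, so [rho] would not distinguish [g] from [g ^ d]; this
    produces words fixed by a relabelling without fixed letters, forcing [rho] to be trivial on [K]
    against [phiz]. *)
Lemma free_quotient : maps_onto_nonabelian_free K.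
Proof.
have [rho rhoP] := free_cut_potential; have [rho1 rhoE] := rhoP.
have N1 : 1 \in N by exact: gpred1.
have phi1 : phi 1 = 0%R by have := phiM 1 N1; rewrite mulg1; lia.
have rhoM g h : h \in K -> rho (g * h) = rho g * rho h.
  apply: potential_mul genG rhoP _ _ _ => a u k kK; have kN := KN kK.
  rewrite /w (upsM u kN) ((cl1 kN).2 kK) mulg1 mulgA (phiM (gen a * u)) // (phiM u) //.
  by congr zpow; lia.
have [eps [epsM eps1 eps_zpow]] := free_exponent Q.
have eps_rho : forall g, eps (rho g) = phi g.
  apply: (generating_ind genG) => [|a g]; first by rewrite rho1 (additive1 epsM) phi1.
  by rewrite rhoE epsM eps_zpow; split; lia.
have rho_conn u v : level_connected gen phi u v -> rho v = rho u.
  move=> uv; apply: (uv (fun g => rho g = rho u)) => // a g E.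
  by rewrite rhoE /w E subrr mul1g.
have [J JE] : exists J : groupClosed (free_group Q),
    forall u, u \in J <-> exists2 g, g \in K & rho g = u.
  apply: subgroup_of => [|_ _ [g gK <-] [h hK <-]|_ [g gK <-]].
  - by exists 1; rewrite ?gpred1.
  - by exists (g * h); rewrite ?gpredM ?rhoM.
  - exists g^-1; rewrite ?gpredV //; apply: (@mulgI _ (rho g)).
    by rewrite -rhoM ?gpredV // !mulgV.
have freeJ := nielsen_schreier (@free_gen_basis Q) J.
exists (subgroup J); split=> //; last first.
  have /choice [f fP] : forall g, exists u : subgroup J, g \in K -> val u = rho g.
    move=> g; have [gK|gK] := boolP (g \in K); last by exists 1.
    have rJ : rho g \in J by apply/JE; exists g.
    by exists (in_subgroup rJ).
  exists f; split=> [g h gK hK|].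
    by apply: val_inj; rewrite fP ?gpredM // rhoM //= !fP.
  apply/seteqP; split=> // u _; have /JE[g gK gu] := valP u.
  by exists g => //; apply: val_inj; rewrite fP.
move=> abJ.
have eps_inj u : u \in J -> eps u = 0%R -> u = 1.
  move=> uJ u0; pose e (v : subgroup J) := eps (val v).
  have eM v v' : e (v * v') = (e v + e v')%R by exact: epsM.
  have zJ : rho z \in J by apply/JE; exists z.
  have ez : e (in_subgroup zJ) <> 0%R by rewrite /e /= eps_rho.
  have := abelian_free_exponent_inj eM freeJ abJ ez (g := in_subgroup uJ) u0.
  by move/(congr1 val).
(* Translation by [d] permutes the letters, without fixed points because [d] is not in [K]; [p] is
   the induced automorphism of the free group. *)
pose s (q : Q) := q * cl d.
have [p pE _] := @free_gen_basis Q _ (t \o s).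
have rho_d g : rho (g * d) = p (rho g) * rho d.
  move: g; apply: (generating_ind genG) => [|a g].
    by rewrite rho1 mult1 !mul1g.
  rewrite -mulgA !rhoE gmulfM (_ : w a (g * d) = p (w a g)).
    by rewrite -mulgA; split=> [->|/mulgI].
  rewrite /w mult_zpow (_ : p (t _) = t (s (ups g))); last exact: pE.
  by rewrite upsM // mulgA (phiM (gen a * g)) // (phiM g) //; congr zpow; lia.
have key g : g \in K -> rho g = 1.
  move=> gK; have gN := KN gK.
  have gdK : g ^ d \in K by apply: NK.2.
  have rho_gd : rho (g ^ d) = rho g.
    apply: divg1_eq; apply: eps_inj.
      apply/JE; exists (g ^ d * g^-1); first by rewrite gpredM ?gpredV.
      rewrite rhoM ?gpredV //; congr (_ * _); apply: (@mulgI _ (rho g)).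
      by rewrite -rhoM ?gpredV // !mulgV.
    rewrite epsM (additiveV epsM) !eps_rho /conjg !phiM ?gpredM //.
    have := phiM d^-1 dN; rewrite mulVg phi1; lia.
  have p_rho : p (rho g) * rho d = rho d * rho g.
    by rewrite -rho_d -rho_gd -rhoM // /conjg mulVKg.
  (* The path from [x] to [x * d] avoids the cut, so [rho] agrees at its two ends. *)
  have y_fix : rho x = p (rho x) * rho d by rewrite -rho_d (rho_conn _ _ xd).
  have : rho x * rho g * (rho x)^-1 = 1.
    apply: (@free_relabel_fixed _ s p) => //.
    - exact: mulIg.
    - move=> q; apply/negP => /eqP E; move/negP: dK; apply; apply/(cl1 dN).
      by apply: (@mulgI _ q); rewrite mulg1.
    - rewrite !gmulfM multV.
      have -> : p (rho x) = rho x * (rho d)^-1 by rewrite [in RHS]y_fix mulgK.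
      by rewrite invgM invgK -!mulgA; congr (_ * _); rewrite !mulgA -(mulgA _ (p _)) p_rho mulKg.
  by move/divg1_eq => E; apply: (@mulgI _ (rho x)); rewrite E mulg1.
by apply: phiz; rewrite -eps_rho key // (additive1 epsM).
Qed.

End FreeQuotient.

Lemma additive_on_X (G : groupType) (N : groupClosed G) (phi : G -> int) h m :
  (forall g k, k \in N -> phi (g * k) = (phi g + phi k)%R) -> h \in N ->
  phi (h ^+ m) = (phi h *+ m)%R.
Proof.
move=> phiM hN; have N1 : 1 \in N by exact: gpred1.
elim: m => [|m IH]; last by rewrite expgSr phiM // IH mulrSr.
by rewrite expg0 mulr0n; have := phiM 1 1 N1; rewrite mulg1; lia.
Qed.

Section Largeness.
Variables (G : groupType) (n : nat) (gen : 'I_n -> G) (rels : seq (seq ('I_n * bool))).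
Hypotheses (genG : generating gen) (rels1 : forall r, r \in rels -> weval gen r = 1).
Hypothesis sc : simply_connected gen rels.

(** The cost per point of the cut: [n] edges at each vertex reached by a cell ratio, and [n] more
    for the jumps over the cut itself. *)
Definition cut_cost := (n * (size (cell_ratios gen rels)).+1)%N.

(** [K] is the preimage in [N] of the subgroup [B] generated by the labels of all edges in relators
    that meet the cut. The rank bound leaves a loop outside the cut whose class is not in [B]. *)
Lemma large_of_cut (N M : groupClosed G) (phi : G -> int) (l : seq G) :
  has_finite_index M -> is_normal N M -> is_abelian (quotient_group N M) ->
  (forall g h, h \in N -> phi (g * h) = (phi g + phi h)%R) ->
  (forall a g, phi (gen a * g) <> phi g -> exists2 x, x \in l & x^-1 * g \in N) ->
  (exists2 h, h \in N & phi h <> 0%R) ->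
  cut_cost * size l < group_rank (quotient_group N M) ->
  exists K : groupClosed G, has_finite_index K /\ maps_onto_nonabelian_free K.
Proof.
move=> finM NM abQ phiM phi_cut [h hN phih] rk.
have [cl [clM cl1 cl_surj]] := quotient_map NM.
have [tau [tau1 tauN tau_inv]] := coset_section N.
pose e a g := (tau (gen a * g))^-1 * (gen a * tau g).
have eM a g : (tau (gen a * g))^-1 * (gen a * g) = e a g * ((tau g)^-1 * g).
  by rewrite /e -!mulgA mulVKg.
have eN a g : e a g \in N.
  have -> : e a g = ((tau (gen a * g))^-1 * (gen a * g)) * ((tau g)^-1 * g)^-1.
    by rewrite eM mulgK.
  by apply: gpredM; rewrite ?gpredV tauN.
have e_inv a g k : k \in N -> e a (g * k) = e a g.
  by move=> kN; rewrite /e (mulgA _ g) (tau_inv (gen a * g)) // (tau_inv g).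
pose YL := [seq y * x | y <- cell_ratios gen rels, x <- l].
pose E := [seq cl (e a g) | a <- enum 'I_n, g <- YL].
have [B BE] : exists B : groupClosed (quotient_group N M), forall q, q \in B <->
    forall H : groupClosed (quotient_group N M), {subset E <= H} -> q \in H.
  apply: subgroup_of => [H _|q q' Hq Hq' H EH|q Hq H EH]; first exact: gpred1.
    by apply: gpredM; [exact: Hq | exact: Hq'].
  by rewrite gpredV; exact: Hq.
have EB : {subset E <= B} by move=> q qE; apply/BE => H; apply.
have [x [d [dN xd dB]]] : exists x d,
    [/\ d \in N, level_connected gen phi x (x * d) & cl d \notin B].
  apply: (exists_level_loop (E := E) genG abQ phiM phi_cut clM cl_surj).
    by move=> H EH q /BE; apply.
  apply: leq_ltn_trans rk.
  rewrite /cut_cost !size_allpairs size_enum_ord mulnS mulnDl addnC -mulnA.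
  by rewrite leq_add2r.
have N1 : 1 \in N by exact: gpred1.
have cl_1 : cl 1 = 1 by apply: (@mulgI _ (cl 1)); rewrite -clM // !mulg1.
have clV g : g \in N -> cl g^-1 = (cl g)^-1.
  by move=> gN; apply: (@mulgI _ (cl g)); rewrite -clM ?gpredV // !mulgV.
have [K KE] : exists K : groupClosed G, forall g, g \in K <-> g \in N /\ cl g \in B.
  apply: subgroup_of => [|g k [gN gB] [kN kB]|g [gN gB]].
  - by rewrite cl_1 !gpred1.
  - by rewrite clM //; split; exact: gpredM.
  - by rewrite clV // !gpredV.
have MK : {subset M <= K}.
  by move=> g gM; have gN := NM.1 _ gM; apply/KE; rewrite (cl1 _ gN).2 ?gpred1.
have NK : is_normal N K.
  split=> [g /KE[]//|g k gN /KE[kN kB]]; apply/KE.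
  have gVN : g^-1 \in N by rewrite gpredV.
  have kgN : k * g \in N by exact: gpredM.
  split; first exact: gpredM.
  by rewrite /conjg !clM // clV // (abQ (cl k)) mulKg.
have finK := finite_index_sup MK finM.
exists K; split=> //.
have [cK [cKM cK1 _]] := quotient_map NK.
(* Along an edge [ups] is multiplied by the class of its label, hence it is constant where the label
   lies in [K]. *)
pose ups g := cK ((tau g)^-1 * g).
(* A power of [h] lies in [K], and [phi] is still nonzero there. *)
have [m m0 hmK] := finite_index_power h finK.
have dK : d \notin K by apply/negP => /KE[_]; apply/negP.
have phihm : phi (h ^+ m) <> 0%R.
  rewrite (additive_on_X m phiM hN) => /eqP; rewrite mulrn_eq0 => /orP[/eqP m0'|/eqP //].
  by rewrite m0' in m0.
apply: (free_quotient genG rels1 sc NK phiM cK1 _ _ dN xd dK hmK phihm (ups := ups)).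
  move=> g k kN; rewrite /ups tau_inv // mulgA cKM //; exact: tauN.
move=> r g a k b k' rr ak jump bk'; rewrite /ups eM cKM ?tauN //.
have [y yY ->] := cell_ratiosP rr bk' ak.
have [u ul uk] := phi_cut _ _ jump.
suff eK : e b (y * k) \in K by rewrite (cK1 _ (eN _ _)).2 ?mul1g.
have -> : y * k = y * u * (u^-1 * k) by rewrite -mulgA mulVKg.
rewrite e_inv //; apply/KE; split; first exact: eN.
apply: EB; apply/allpairsP; exists (b, y * u); rewrite mem_enum; split=> //.
by apply/allpairsP; exists (y, u).
Qed.

Lemma large_of_chain (H N M : groupClosed G) q :
  has_finite_index M -> is_normal H N -> is_normal N M ->
  is_abelian (quotient_group H N) -> is_abelian (quotient_group N M) ->
  0 < q -> (forall r, r \in rels -> size r <= q) ->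
  q ^ (n * subgroup_index predT H) < subgroup_index H N ->
  cut_cost * (n * subgroup_index predT N) < group_rank (quotient_group N M) * q ->
  exists K : groupClosed G, has_finite_index K /\ maps_onto_nonabelian_free K.
Proof.
move=> finM NH MN abHN abNM q0 relsq big rk.
have finN := finite_index_sup MN.1 finM; have finH := finite_index_sup NH.1 finN.
have finHN : finite_set (left_cosets H N).
  by apply: sub_finite_set finN => c [x _ <-]; exists x.
have [k [eta [k0 eta1 etaM eta_small [etaN [h hH etah]]]]] :=
  small_cocycle genG rels1 sc NH finH finHN abHN q0 relsq big.
have etaMN g x : x \in N -> eta (g * x) = (eta g + eta x)%R by move=> /(NH.1)/etaM.
have [phi [l [phiM eta_phi lq phi_cut]]] := cut finN k0 eta1 etaMN eta_small etaN.
apply: (large_of_cut finM MN abNM phiM phi_cut).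
  have [m m0 hmN] := finite_index_power h finN; exists (h ^+ m) => // phi0.
  have := eta_phi _ hmN; rewrite phi0 mul0r (additive_on_X m etaM hH) => /eqP.
  by rewrite mulrn_eq0 => /orP[/eqP m0'|/eqP //]; rewrite m0' in m0.
rewrite -(ltn_pmul2r q0); apply: leq_ltn_trans rk.
by rewrite -mulnA leq_mul2l lq orbT.
Qed.

End Largeness.

Section Limits.
Variable R : realType.
Local Open Scope ring_scope.

(** A number strictly between 0 and the infimum of the tail suprema is exceeded in every tail; if
    that infimum is infinite, 1 will do. *)
Lemma limn_esup_gt0 (u : nat -> R) : (0 < limn_esup (fun i => (u i)%:E))%E ->
  exists2 c, 0 < c & forall i0, exists2 i, (i0 <= i)%N & c < u i.
Proof.
set v := fun i => (u i)%:E; rewrite limn_esup_lim (cvg_lim _ (@cvg_esups_inf R v)) // => v0.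
have [c c0 cv] : exists2 c : R, 0 < c & (c%:E < ereal_inf (range (esups v)))%E.
  case: (ereal_inf _) v0 => [r|_|//]; last by exists 1; rewrite ?ltry.
  by rewrite lte_fin => r0; exists (r / 2); rewrite ?lte_fin; lra.
exists c => // i0.
have : (c%:E < esups v i0)%E.
  by apply: lt_le_trans cv _; apply: ereal_inf_lbound; exists i0.
by move=> /ereal_sup_gt[_ [i /= i0i <-]]; rewrite lte_fin; exists i.
Qed.

End Limits.

Lemma subgroup_index_gt0 (G : groupType) (N : groupClosed G) :
  has_finite_index N -> 0 < subgroup_index predT N.
Proof.
move=> /transversal_uniqP[s [[_ cov _] _ <-]].
by have [x xs _] := cov 1 isT; case: s xs {cov}.
Qed.

Lemma large_of_series (R : realType) (G : groupType) (Gs : nat -> groupClosed G) :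
  finitely_presented G ->
  (forall i, {subset Gs i.+1 <= Gs i}) ->
  (forall i, has_finite_index (Gs i)) ->
  (forall i, is_normal (Gs 0) (Gs i)) ->
  (forall i, is_abelian (quotient_group (Gs i) (Gs i.+1))) ->
  ((fun i => ln (subgroup_index (Gs i) (Gs i.+1))%:R
     / (subgroup_index predT (Gs i))%:R : R)%R @ \oo --> +oo%R) ->
  (0 < limn_esup (fun i => ((group_rank (quotient_group (Gs i) (Gs i.+1)))%:R
     / (subgroup_index predT (Gs i))%:R : R)%R%:E))%E ->
  exists K : groupClosed G, has_finite_index K /\ maps_onto_nonabelian_free K.
Proof.
move=> Gfp sub fin nor ab order rank.
have [n [gen [rels [genG rels1 sc]]]] := finitely_presented_simply_connected Gfp.
have sub0 i : {subset Gs i <= Gs 0} by elim: i => // i IH g /sub/IH.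
have norS i : is_normal (Gs i) (Gs i.+1).
  by split; [exact: sub | move=> x y /sub0 x0 yi; apply: (nor i.+1).2].
have [c c0 rankc] := limn_esup_gt0 rank.
pose C := cut_cost gen rels.
pose L := \max_(r <- rels) size r.
(* [q] bounds the relator lengths and is so large that rank above [c [G : N]] exceeds the cost of a
   cut of size [n [G : N] / q]. *)
have [q [q1 Lq Cq]] : exists q, [/\ 0 < q, L <= q & ((C * n)%N%:R < c * q%:R)%R].
  have [m mP] : exists m, ((C * n)%N%:R / c < m%:R)%R.
    by exists (Num.truncn ((C * n)%N%:R / c)%R).+1; apply: truncnS_gt.
  exists (maxn m.+1 L); split; rewrite ?leq_maxr // ?(leq_trans _ (leq_maxl _ _)) //.
  rewrite -ltr_pdivrMl // mulrC; apply: lt_le_trans mP _.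
  by rewrite ler_nat (leq_trans _ (leq_maxl _ _)).
have relsq r : r \in rels -> size r <= q.
  by move=> rr; apply: leq_trans Lq; rewrite /L (big_rem r) //= leq_maxl.
have q0R : (0 < q%:R :> R)%R by rewrite ltr0n.
have idx_gt0 i : (0 < (subgroup_index predT (Gs i))%:R :> R)%R.
  by rewrite ltr0n subgroup_index_gt0.
have [i0 _ big] : \forall i \near \oo, (n%:R * ln q%:R <
    ln (subgroup_index (Gs i) (Gs i.+1))%:R / (subgroup_index predT (Gs i))%:R :> R)%R.
  by move/cvgryPgt: order; apply.
(* The rank is large at [i.+1] and the index growth is used one step earlier, so the three
   consecutive terms start at [i]. *)
have [[//|i] i0i rki] := rankc i0.+1.
apply: (large_of_chain genG rels1 sc (fin i.+2) (norS i) (norS i.+1) (ab i) (ab i.+1) q1 relsq).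
  have := big i i0i; rewrite ltr_pdivlMr //.
  set N := subgroup_index (Gs i) _; set m := subgroup_index predT _ => lt.
  have N0 : 0 < N.
    (* An index 0 would have logarithm 0 by convention, which is not above the nonnegative bound. *)
    rewrite lt0n; apply/eqP => N0; move: lt; rewrite N0 mulr0n (ln0 (lexx 0%R)) ltNge => /negP; apply.
    by rewrite !mulr_ge0 // ln_ge0 // ler1n.
  rewrite -(ltr_nat R) natrX -ltr_ln ?posrE ?exprn_gt0 ?ltr0n // lnXn //.
  by rewrite -[ltLHS]mulr_natl natrM mulrAC.
rewrite -(ltr_nat R); move: rki; rewrite ltr_pdivlMr //.
set rk := group_rank _; set m := subgroup_index predT _ => rki.
rewrite natrM; apply: le_lt_trans (_ : c * m%:R * q%:R < _)%R; last by rewrite natrM ltr_pM2r.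
by rewrite [leRHS]mulrAC natrM mulrA -natrM ler_wpM2r // ltW.
Qed.

(** * From a free quotient to the series *)

Section IndexBounds.
Variable G : groupType.
Implicit Types (H K D : groupClosed G).

Lemma index_mul (A : {pred G}) K D :
  finite_set (left_cosets A K) -> finite_set (left_cosets K D) ->
  finite_set (left_cosets A D) /\
  subgroup_index A D <= subgroup_index A K * subgroup_index K D.
Proof.
move=> finK finD.
have [s [[sA s_cov _] _ sn]] := transversal_uniqP finK.
have [t [[tK t_cov _] _ tn]] := transversal_uniqP finD.
rewrite -sn -tn -(size_allpairs (fun x y => x * y)).
apply: covering_index => g gA; have [x xs xg] := s_cov g gA; have [y yt yg] := t_cov _ xg.
exists (x * y); last by rewrite invgM -mulgA.
by apply/allpairsP; exists (x, y).
Qed.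

Lemma index_ge (K : {pred G}) D (U : finType) (g : U -> G) :
  finite_set (left_cosets K D) -> (forall u, g u \in K) ->
  (forall u v, (g u)^-1 * g v \in D -> u = v) -> #|U| <= subgroup_index K D.
Proof.
move=> fin gK g_inj; have [s [[_ cov _] _ <-]] := transversal_uniqP fin.
have /choice [r rP] : forall u, exists x, x \in s /\ x^-1 * g u \in D.
  by move=> u; have [x ? ?] := cov _ (gK u); exists x.
have r_inj : injective r.
  move=> u v E; apply: g_inj; have [_ ru] := rP u; have [_ rv] := rP v; rewrite E in ru.
  have -> : (g u)^-1 * g v = ((r v)^-1 * g u)^-1 * ((r v)^-1 * g v).
    by rewrite invgM invgK -!mulgA mulVKg.
  by apply: gpredM rv; rewrite gpredV.
rewrite cardE -(size_map r); apply: uniq_leq_size; first by rewrite map_inj_uniq ?enum_uniq.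
by move=> _ /mapP[u _ ->]; case: (rP u).
Qed.

Lemma schreier_generators n (gen : 'I_n -> G) K : generating gen -> has_finite_index K ->
  exists s : seq G, {subset s <= K} /\
    forall L : groupClosed G, {subset s <= L} -> {subset K <= L}.
Proof.
move=> genG fin; have [v [[_ v_cov _] _ _]] := transversal_uniqP fin.
have [tau [tau1 tauK tau_inv]] := coset_section K.
pose e a g := (tau (gen a * g))^-1 * (gen a * tau g).
have eM a g : (tau (gen a * g))^-1 * (gen a * g) = e a g * ((tau g)^-1 * g).
  by rewrite /e -!mulgA mulVKg.
have eK a g : e a g \in K.
  have -> : e a g = ((tau (gen a * g))^-1 * (gen a * g)) * ((tau g)^-1 * g)^-1.
    by rewrite eM mulgK.
  by apply: gpredM; rewrite ?gpredV tauK.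
exists [seq e a x | a <- enum 'I_n, x <- v]; split.
  by move=> _ /allpairsP[[a x] [_ _ ->]].
move=> L sL.
have eL a g : e a g \in L.
  have [x xv xg] := v_cov g isT; have -> : g = x * (x^-1 * g) by rewrite mulVKg.
  rewrite /e (mulgA _ x) (tau_inv (gen a * x)) // (tau_inv x) //.
  by apply: sL; apply/allpairsP; exists (a, x); rewrite mem_enum.
have tL : forall g, (tau g)^-1 * g \in L.
  apply: (generating_ind genG) => [|a g]; first by rewrite tau1 mulg1 invg1 gpred1.
  rewrite eM; move: ((tau g)^-1 * g) => z.
  by have -> : (e a g * z \in L) = (z \in L) by rewrite gpredMl.
move=> g gK; have := tL g.
by rewrite -{1}(mul1g g) tau_inv // tau1 invg1 mul1g.
Qed.

End IndexBounds.

(** Each further generator multiplies the size of the list by [p]. This converts a lower bound on an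
    index into one on a rank. *)
Lemma elementary_abelian_card (A : groupType) p (s : seq A) :
  is_abelian A -> 0 < p -> (forall a : A, a ^+ p = 1) -> generates s ->
  exists t : seq A, size t = (p ^ size s)%N /\ forall a, a \in t.
Proof.
move=> abA p0 expA /generatesP gs.
suff [B [t [sB tn Bt]]] : exists (B : groupClosed A) (t : seq A),
    [/\ {subset s <= B}, size t = (p ^ size s)%N & {subset B <= t}].
  by exists t; split=> // a; apply: Bt; exact: gs.
elim: s {gs} => [|x s [B [t [sB tn Bt]]]].
  have [B BE] : exists B : groupClosed A, forall a, a \in B <-> a = 1.
    by apply: subgroup_of => [//|_ _ -> ->|_ ->]; rewrite ?mulg1 ?invg1.
  by exists B, [:: 1]; split=> // a /BE ->; rewrite inE.
have [B' B'E] : exists B' : groupClosed A, forall a, a \in B' <-> exists2 e, e < p & a / x ^+ e \in B.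
  have red a e : a / x ^+ e \in B -> exists2 e', e' < p & a / x ^+ e' \in B.
    move=> aB; exists (e %% p); rewrite ?ltn_mod //.
    suff <- : x ^+ e = x ^+ (e %% p) by [].
    by rewrite {1}(divn_eq e p) expgnDr mulnC expgnA expA expg1n mul1g.
  apply: subgroup_of => [|a b [d _ aB] [e _ bB]|a [e ep aB]].
  - by exists 0; rewrite ?divg1 ?gpred1.
  - apply: (red _ (d + e)); have -> : a * b / x ^+ (d + e) = (a / x ^+ d) * (b / x ^+ e).
      by rewrite expgnDr (abelian_invM abA) (abelian_mulgACA abA).
    exact: gpredM.
  - apply: (red _ (p - e)); rewrite -gpredV.
    have -> : (a^-1 / x ^+ (p - e))^-1 = a / x ^+ e; last by [].
    rewrite (abelian_invM abA) !invgK expgnFr ?(ltnW ep) // expA mul1g //.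
exists B', [seq b * x ^+ e | b <- t, e <- iota 0 p]; split.
- move=> a; rewrite inE => /orP[/eqP ->|/sB aB]; apply/B'E.
    have [p1|p1] := leqP p 1; last by exists 1%N; rewrite ?mulgV ?gpred1.
    have p1' : p = 1%N by apply/eqP; rewrite eqn_leq p1.
    by exists 0; rewrite ?divg1 // -[x]expg1 -p1' expA gpred1.
  by exists 0; rewrite ?divg1.
- by rewrite size_allpairs tn size_iota expnSr.
- move=> a /B'E[e ep aB]; apply/allpairsP; exists (a / x ^+ e, e).
  by rewrite /= mem_iota mulgVK Bt.
Qed.

Section FreeStep.
Variables (G F : groupType) (H : groupClosed G) (f : G -> F).
Hypothesis fM : {in H &, {morph f : x y / x * y}}.
Hypothesis f_surj : f @` [set` H] = [set: F].
Variables (X : Type) (b : X -> F).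
Hypothesis bF : is_free_basis b.
Variable s : bool -> X.
Hypothesis s_neq : s true <> s false.
Variable p : nat.
Hypothesis p_pr : prime p.

(** For such [K] inside [H], cosets of [K] in [H] correspond to cosets of its image in [F]. *)
Definition saturated (K : groupClosed G) := forall g, g \in H -> f g = 1 -> g \in K.

Definition char_on (K : groupClosed G) (psi : G -> 'F_p) :=
  {in K &, forall g h, psi (g * h) = (psi g + psi h)%R} /\
  forall g, g \in K -> f g = 1 -> psi g = 0%R.

Section Step.
Variable K : groupClosed G.
Hypotheses (KH : is_normal H K) (finK : finite_set (left_cosets H K)) (satK : saturated K).

Lemma f1 : f 1 = 1.
Proof.
have H1 : 1 \in H by exact: gpred1.
by apply: (@mulgI _ (f 1)); rewrite -fM // !mulg1.
Qed.

Lemma fV g : g \in H -> f g^-1 = (f g)^-1.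
Proof. by move=> gH; apply: (@mulgI _ (f g)); rewrite -fM ?gpredV // !mulgV f1. Qed.

(** With [m = [H : K]], the coset graph has [2 m] edges labelled [s true] or [s false]. Integrating
    the indicator of each gives a character, evaluated at the Schreier generators of the same edges.
    The resulting matrix is the identity minus a coboundary correction of rank at most [m]. *)
Lemma many_chars : exists (N : nat) (psi : 'I_N -> G -> 'F_p) (kappa : 'I_N -> G),
  [/\ forall q, char_on K (psi q), forall q, kappa q \in K &
      subgroup_index H K <= \rank (\matrix_(i, q) psi q (kappa i))%R].
Proof.
have [v [[vH v_cov v_inj] uv vm]] := transversal_uniqP finK.
set m := subgroup_index H K in vm *.
pose vi (i : 'I_m) := nth 1 v i.
have viP i : vi i \in v by rewrite mem_nth ?vm.
have viH i : vi i \in H by exact: vH.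
have vi_inj i j : (vi i)^-1 * vi j \in K -> i = j.
  move=> /v_inj E; apply/val_inj/eqP; rewrite -(nth_uniq 1 _ _ uv) ?vm ?ltn_ord //.
  by apply/eqP/E.
have vi_cov g : g \in H -> exists i, (vi i)^-1 * g \in K.
  move=> /v_cov[x xv xg]; have ixm : index x v < m by rewrite -vm index_mem.
  by exists (Ordinal ixm); rewrite /vi /= nth_index.
have KinH : {subset K <= H} by case: KH.
have fMK g h : g \in K -> h \in K -> f (g * h) = f g * f h.
  by move=> gK hK; apply: fM; exact: KinH.
have [J JE] : exists J : groupClosed F, forall u, u \in J <-> exists2 g, g \in K & f g = u.
  apply: subgroup_of => [|_ _ [g gK <-] [h hK <-]|_ [g gK <-]].
  - by exists 1; rewrite ?gpred1 ?f1.
  - by exists (g * h); [exact: gpredM | rewrite fMK].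
  - by exists g^-1; [rewrite gpredV | rewrite fV // KinH].
have fJ g : g \in H -> (f g \in J) = (g \in K).
  move=> gH; apply/idP/idP => [/JE[h hK fh]|gK]; last by apply/JE; exists g.
  have hH := KinH _ hK; have hVH : h^-1 \in H by rewrite gpredV.
  rewrite -(mulVKg h g); apply: gpredM => //; apply: satK; first exact: gpredM.
  by rewrite fM // fV // fh mulVg.
pose A := Algebra.to_multiplicative 'F_p.
pose hit (q : 'I_m * bool) (a : X) (u : F) := `[< a = s q.2 >] && ((f (vi q.1))^-1 * u \in J).
pose w q a u : A := (hit q a u)%:R%R.
have /choice [eta etaP] : forall q, exists eta, is_potential b (w q) eta.
  by move=> q; exact: free_potential.
have eta_b q a u : eta q (b a * u) = (w q a u + eta q u)%R :> 'F_p by case: (etaP q) => _ /(_ a u).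
have etaJ q u k : k \in J -> eta q (u * k) = (eta q u + eta q k)%R :> 'F_p.
  apply: potential_mul (free_generating bF) (etaP q) _ _ _ => a u' k' k'J.
  rewrite /w /hit mulgA (_ : (_ * k' \in J) = ((f (vi q.1))^-1 * u' \in J)) //.
  move: ((f (vi q.1))^-1 * u') => z.
  by apply/idP/idP => zJ; [rewrite -(mulgK k' z); apply: gpredM; rewrite ?gpredV | exact: gpredM].
have /choice [a_ aP] : forall c, exists g, g \in H /\ f g = b (s c).
  move=> c; have : [set: F] (b (s c)) by [].
  by rewrite -f_surj => -[g gH gE]; exists g.
have aH c : a_ c \in H by case: (aP c).
have /choice [sg sgP] : forall q : 'I_m * bool, exists i, (vi i)^-1 * (a_ q.2 * vi q.1) \in K.
  by move=> q; apply: vi_cov; apply: gpredM.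
pose kap (q : 'I_m * bool) := (vi (sg q))^-1 * (a_ q.2 * vi q.1).
pose psi (q : 'I_m * bool) g : 'F_p := eta q (f g).
have psi_kap q q' :
    psi q (kap q') = ((q == q')%:R + eta q (f (vi q'.1)) - eta q (f (vi (sg q'))))%R.
  have kK : kap q' \in K by exact: sgP.
  have kH : kap q' \in H by exact: KinH.
  have : eta q (f (vi (sg q') * kap q')) = (eta q (f (vi (sg q'))) + psi q (kap q'))%R :> 'F_p.
    by rewrite fM // etaJ // fJ.
  rewrite mulVKg fM // (aP q'.2).2 eta_b => /(congr1 (fun z => z - eta q (f (vi (sg q'))))%R).
  rewrite [X in _ = X -> _]addrC addKr => <-; congr (_ + _ - _)%R.
  rewrite /w /hit; congr (nat_of_bool _)%:R%R.
  have -> : ((f (vi q.1))^-1 * f (vi q'.1) \in J) = (q.1 == q'.1).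
    have vVH : (vi q.1)^-1 \in H by rewrite gpredV.
    rewrite -fV // -fM // fJ; last exact: gpredM.
    by apply/idP/eqP => [E|->]; [exact: vi_inj | rewrite mulVg gpred1].
  have -> : `[< s q'.2 = s q.2 >] = (q.2 == q'.2).
    apply/asboolP/eqP => [|->//]; case: q.2 q'.2 => [] [] // E; case: s_neq; by rewrite E.
  by rewrite andbC -xpair_eqE -!surjective_pairing.
pose T := ('I_m * bool)%type; pose N := #|{: T}|.
have NE : N = (m + m)%N by rewrite /N card_prod card_ord card_bool muln2 addnn.
exists N, (fun i => psi (enum_val i)), (fun i => kap (enum_val i)); split.
- move=> i; set q := enum_val i; split=> [g h gK hK|g gK fg].
    by rewrite /psi fMK // etaJ // fJ ?KinH.
  by rewrite /psi fg; case: (etaP q).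
- by move=> i; exact: sgP.
(* The correction in [psi_kap] is a difference of potentials at the two ends of an edge, so it
   factors through the [m] vertices. *)
pose P1 : 'M['F_p]_(N, m) := (\matrix_(i, j) ((j == (enum_val i).1)%:R - (j == sg (enum_val i))%:R))%R.
pose P2 : 'M['F_p]_(m, N) := (\matrix_(j, q) eta (enum_val q) (f (vi j)))%R.
have -> : (\matrix_(i, q) psi (enum_val q) (kap (enum_val i)))%R = (1%:M + P1 *m P2)%R.
  apply/matrixP => i q; rewrite !mxE psi_kap -addrA; congr (_ + _)%R.
    by rewrite (inj_eq enum_val_inj) eq_sym.
  rewrite (eq_bigr (fun j => (j == (enum_val i).1)%:R * P2 j q - (j == sg (enum_val i))%:R * P2 j q)%R).
    rewrite sumrB (bigD1 (enum_val i).1) //= big1 => [|j /negPf ->]; last by rewrite mul0r.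
    rewrite (bigD1 (sg (enum_val i))) //= big1 => [|j /negPf ->]; last by rewrite mul0r.
    by rewrite !eqxx !mul1r !addr0 !mxE.
  by move=> j _; rewrite mxE mulrBl.
have := mxrank_add (1%:M + P1 *m P2)%R (- (P1 *m P2))%R.
rewrite addrK mxrank1 mxrank_opp => le.
have le_m : \rank (P1 *m P2)%R <= m by exact: leq_trans (mxrankM_maxr _ _) (rank_leq_row _).
by rewrite -(leq_add2r m) -NE (leq_trans le) // leq_add2l.
Qed.

Variable gs : seq G.
Hypotheses (gsK : {subset gs <= K})
  (gs_gen : forall L : groupClosed G, {subset gs <= L} -> {subset K <= L}).

(** [D] is the common kernel of the characters in [char_on K], normal in [H] because conjugation by
    [H] permutes them. The rank of the matrix bounds the index from below, and the quotient has
    exponent [p], so its rank is bounded too. *)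
Lemma frattini_step : exists D : groupClosed G,
  [/\ {subset D <= K}, is_normal H D, saturated D, is_abelian (quotient_group K D) &
   [/\ finite_set (left_cosets K D), p ^ subgroup_index H K <= subgroup_index K D &
       subgroup_index H K <= group_rank (quotient_group K D)]].
Proof.
have KinH : {subset K <= H} by case: KH.
have K1 : 1 \in K by exact: gpred1.
have char1 psi : char_on K psi -> psi 1 = 0%R.
  by case=> psiM _; have /eqP := psiM 1 1 K1 K1; rewrite mulg1 -subr_eq subrr => /eqP.
have charV psi g : char_on K psi -> g \in K -> psi g^-1 = (- psi g)%R.
  move=> psiC gK; have gVK : g^-1 \in K by rewrite gpredV.
  have := psiC.1 _ _ gK gVK; rewrite mulgV char1 // => /esym/eqP.
  by rewrite addrC addr_eq0 => /eqP.
have [D DE] : exists D : groupClosed G, forall g, g \in D <->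
    g \in K /\ forall psi, char_on K psi -> psi g = 0%R.
  apply: subgroup_of => [|g h [gK g0] [hK h0]|g [gK g0]].
  - by split=> // psi; exact: char1.
  - by split=> [|psi psiC]; [exact: gpredM | rewrite psiC.1 // g0 // h0 // addr0].
  - by split=> [|psi psiC]; [rewrite gpredV | rewrite charV // g0 // oppr0].
have DK : {subset D <= K} by move=> g /DE[].
have KJ g h : g \in K -> h \in H -> g ^ h \in K by move=> gK hH; exact: KH.2.
have DH : is_normal H D.
  split=> [g /DK/KinH //|h g hH /DE[gK g0]]; apply/DE; split; first exact: KJ.
  move=> psi psiC; apply: (g0 (fun u => psi (u ^ h))); split=> [u v uK vK|u uK fu].
    by rewrite conjMg psiC.1 ?KJ.
  have hVH : h^-1 \in H by rewrite gpredV.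
  have uH := KinH _ uK; have uhH : u * h \in H by exact: gpredM.
  by apply: psiC.2; rewrite ?KJ // /conjg !fM // fu mul1g -fM // mulVg f1.
have DN : is_normal K D by split=> // x y xK; apply: DH.2; exact: KinH.
have satD : saturated D.
  move=> g gH fg; have gK := satK gH fg; apply/DE; split=> // psi psiC; exact: psiC.2.
have [cl [clM cl1 cl_surj]] := quotient_map DN.
have cl_eq g h : g \in K -> h \in K -> cl g = cl h -> g^-1 * h \in D.
  move=> gK hK E; have gVK : g^-1 \in K by rewrite gpredV.
  apply/cl1; first exact: gpredM.
  by rewrite clM // -E -clM // mulVg; apply/cl1; rewrite ?gpred1.
have cl_eq' g h : g \in K -> h \in K -> g^-1 * h \in D -> cl g = cl h.
  move=> gK hK /[dup] ghD /DK ghK.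
  by rewrite -[in RHS](mulVKg g h) clM // (cl1 _ ghK).2 ?mulg1.
have abQ : is_abelian (quotient_group K D).
  move=> x y; have [g gK ->] := cl_surj x; have [h hK ->] := cl_surj y.
  have ghK : g * h \in K by exact: gpredM.
  have hgK : h * g \in K by exact: gpredM.
  have ghVK : (g * h)^-1 \in K by rewrite gpredV.
  rewrite /commute -!clM //; apply: cl_eq' => //; apply/DE; split; first exact: gpredM.
  move=> psi psiC; rewrite psiC.1 // charV // !psiC.1 //.
  by rewrite [X in (- X + _)%R]addrC addNr.
have clX g k : g \in K -> cl (g ^+ k) = cl g ^+ k.
  move=> gK; elim: k => [|k IH]; last by rewrite !expgS clM ?IH // gpredXn.
  by apply/cl1; rewrite // gpred1.
have charX psi g k : char_on K psi -> g \in K -> psi (g ^+ k) = (psi g *+ k)%R.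
  move=> psiC gK; elim: k => [|k IH]; first exact: char1.
  by rewrite expgS psiC.1 ?gpredXn // IH mulrS.
have Fp0 : (p%:R = 0 :> 'F_p)%R by exact: pchar_Fp_0.
have expQ (x : quotient_group K D) : x ^+ p = 1.
  have [g gK ->] := cl_surj x; rewrite -clX //; apply/cl1; first exact: gpredXn.
  apply/DE; split=> [|psi psiC]; first exact: gpredXn.
  by rewrite charX // -mulr_natr Fp0 mulr0.
have gen_gs : generates (map cl gs).
  apply/generatesP => L gsL x; have [g gK ->] := cl_surj x.
  have [L' L'E] : exists L' : groupClosed G, forall u, u \in L' <-> u \in K /\ cl u \in L.
    apply: subgroup_of => [|u v [uK uL] [vK vL]|u [uK uL]].
    - by rewrite (cl1 _ K1).2 !gpred1.
    - by rewrite clM //; split; exact: gpredM.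
    - have uVK : u^-1 \in K by rewrite gpredV.
      split=> //; rewrite (_ : cl u^-1 = (cl u)^-1) ?gpredV //.
      apply: (@mulgI _ (cl u)); rewrite -clM // !mulgV.
      by apply/cl1; rewrite // gpred1.
  have /(_ _ gK)/L'E[] // : {subset K <= L'}.
  by apply: gs_gen => u ugs; apply/L'E; split; [exact: gsK | apply: gsL; exact: map_f].
have [_ [t gen_t t_rank]] := group_rankP gen_gs.
have [u [u_size uQ]] := elementary_abelian_card abQ (prime_gt0 p_pr) expQ gen_t.
have /choice [r rP] : forall x, exists g, g \in K /\ x = cl g.
  by move=> x; have [g ? ?] := cl_surj x; exists g.
have [finD idx_le] : finite_set (left_cosets K D) /\ subgroup_index K D <= size (map r u).
  apply: covering_index => g gK; exists (r (cl g)); first exact: map_f.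
  by apply: cl_eq => //; [case: (rP (cl g)) | case: (rP (cl g))].
have idx_ge : p ^ subgroup_index H K <= subgroup_index K D.
  have [N [psi [kappa [psiC kappaK rank_ge]]]] := many_chars.
  set M := (\matrix_(i, q) _)%R in rank_ge.
  (* Products of powers of the [kappa i] realise every vector of the row space of [M]; distinct
     vectors lie in distinct cosets of [D]. *)
  have lift (c : 'rV['F_p]_N) : exists2 g, g \in K & forall q, psi q g = (c *m M)%R ord0 q.
    pose k i : G := kappa i ^+ c ord0 i.
    exists (\prod_(i < N) k i); first by apply: gpred_prod => i _; exact: gpredXn.
    move=> q; rewrite mxE.
    suff [] : \prod_(i < N) k i \in K /\
      psi q (\prod_(i < N) k i) = (\sum_(i < N) c ord0 i * M i q)%R by [].
    apply: (big_ind2 (fun g z => g \in K /\ psi q g = z)).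
    - by split=> //; exact: char1.
    - by move=> g z g' z' [gK <-] [g'K <-]; split; [exact: gpredM | rewrite (psiC q).1].
    - move=> i _; split; first exact: gpredXn.
      by rewrite /k charX // mxE -[in RHS](natr_Zp (c ord0 i)) mulr_natl.
  have /choice [g gP] : forall v : 'rV['F_p]_(\rank M), exists g,
      g \in K /\ forall q, psi q g = (v *m row_base M)%R ord0 q.
    move=> v; have /submxP[c cE] : ((v *m row_base M)%R <= M)%MS.
      by rewrite (submx_trans (submxMl _ _)) // eq_row_base.
    by have [g gK gE] := lift c; exists g; split=> // q; rewrite gE -cE.
  have := @index_ge _ K D 'rV['F_p]_(\rank M) g finD.
  rewrite card_mx mul1n card_Fp // => ge; apply: leq_trans (ge _ _).
  - by rewrite leq_exp2l // prime_gt1.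
  - by move=> v; case: (gP v).
  - move=> v v' vD; apply: (row_free_inj (row_base_free M)).
    apply/rowP => q; have [vK vE] := gP v; have [v'K v'E] := gP v'.
    rewrite -vE -v'E; have vVK : (g v)^-1 \in K by rewrite gpredV.
    have /DE[_ /(_ _ (psiC q))] := vD; rewrite (psiC q).1 // charV // => /eqP.
    by rewrite addrC subr_eq0 => /eqP.
exists D; split=> //; split=> //.
rewrite -t_rank -(leq_exp2l _ _ (prime_gt1 p_pr)); apply: leq_trans idx_ge _.
by apply: leq_trans idx_le _; rewrite size_map u_size.
Qed.

End Step.
End FreeStep.

Lemma series_of_large (R : realType) (G : groupType) (H : groupClosed G) :
  finitely_presented G -> has_finite_index H -> maps_onto_nonabelian_free H ->
  exists Gs : nat -> groupClosed G,
    (forall i, {subset Gs i.+1 <= Gs i}) /\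
    (forall i, has_finite_index (Gs i)) /\
    (forall i, is_normal (Gs 0) (Gs i)) /\
    (forall i, is_abelian (quotient_group (Gs i) (Gs i.+1))) /\
    ((fun i => ln (subgroup_index (Gs i) (Gs i.+1))%:R
       / (subgroup_index predT (Gs i))%:R : R)%R @ \oo --> +oo%R) /\
    (0 < limn_esup (fun i => ((group_rank (quotient_group (Gs i) (Gs i.+1)))%:R
       / (subgroup_index predT (Gs i))%:R : R)%R%:E))%E.
Proof.
move=> Gfp finH [F [[X [b bF]] nabF [f [fM f_surj]]]].
have [n [gen [rels [genG _ _]]]] := finitely_presented_simply_connected Gfp.
have [x [y xy]] := nonabelian_basis bF nabF.
pose s (c : bool) := if c then x else y.
have s_neq : s true <> s false by move=> E; apply: xy; congr b.
pose good K := [/\ is_normal H K, has_finite_index K & saturated H f K].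
pose next (i : nat) (K D : groupClosed G) := [/\ good D, {subset D <= K},
  is_abelian (quotient_group K D),
  (i%:R * (subgroup_index H K)%:R <= ln (subgroup_index K D)%:R :> R)%R &
  subgroup_index H K <= group_rank (quotient_group K D)].
have /choice [S SP] : forall q : nat * groupClosed G, exists D, good q.2 -> next q.1 q.2 D.
  move=> [i K] /=; have [[KH finK satK]|bad] := pselect (good K); last by exists H.
  have finHK : finite_set (left_cosets H K).
    by apply: sub_finite_set finK => c [u _ <-]; exists u.
  have [gs [gsK gs_gen]] := schreier_generators genG finK.
  (* A prime above [exp i] gives [ln p >= i], hence [ln [K : D] >= i [H : K]], and this ratio tends
     to infinity along the series. *)
  have [p p_gt p_pr] := prime_above (Num.truncn (expR i%:R : R)).+1.
  have [D [DK DH satD abQ [finD idx rk]]] :=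
    frattini_step fM f_surj bF s_neq p_pr KH finHK satK gsK gs_gen.
  have finGD : has_finite_index D by case: (index_mul finK finD).
  exists D => _; split=> //.
  have p0 : (0 < p%:R :> R)%R by rewrite ltr0n prime_gt0.
  have lnp : (i%:R <= ln p%:R :> R)%R.
    rewrite -[leLHS]expRK ler_ln ?posrE ?expR_gt0 //.
    by apply/ltW/(lt_trans (truncnS_gt _)); rewrite ltr_nat.
  apply: (@le_trans _ _ (ln (p ^ subgroup_index H K)%N%:R)%R).
    by rewrite natrX lnXn // -[leRHS]mulr_natr ler_wpM2r.
  have pm0 : (0 < (p ^ subgroup_index H K)%N%:R :> R)%R by rewrite ltr0n expn_gt0 prime_gt0.
  by rewrite ler_ln ?posrE ?ler_nat // (lt_le_trans pm0) // ler_nat.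
pose fix Gs i : groupClosed G := if i is i'.+1 then S (i', Gs i') else H.
have Ggood i : good (Gs i).
  elim: i => [|i IH]; last by case: (SP (i, Gs i) IH).
  by split=> //; split=> // u v uH vH; exact: gpredJ.
have Gnext i : next i (Gs i) (Gs i.+1) := SP (i, Gs i) (Ggood i).
pose h := subgroup_index predT H; have h0 : 0 < h by exact: subgroup_index_gt0.
have idx0 i : (0 < (subgroup_index predT (Gs i))%:R :> R)%R.
  by rewrite ltr0n subgroup_index_gt0 //; case: (Ggood i).
have h0R : (0 < h%:R :> R)%R by rewrite ltr0n.
have idx_le i : ((subgroup_index predT (Gs i))%:R <= h%:R * (subgroup_index H (Gs i))%:R :> R)%R.
  rewrite -natrM ler_nat; case: (Ggood i) => _ finGi _.
  have finHi : finite_set (left_cosets H (Gs i)).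
    by apply: sub_finite_set finGi => c [u _ <-]; exists u.
  by have [] := index_mul finH finHi.
exists Gs; split; [|split; [|split; [|split; [|split]]]].
- by move=> i; case: (Gnext i).
- by move=> i; case: (Ggood i).
- by move=> i; case: (Ggood i).
- by move=> i; case: (Gnext i).
- apply/cvgryPge => A; near=> i.
  have Ai : (A * h%:R <= i%:R)%R by near: i; exact: nbhs_infty_ger.
  have [_ _ _ big _] := Gnext i; rewrite ler_pdivlMr //.
  apply: le_trans big; have [A0|A0] := lerP 0 A; last first.
    by rewrite (@le_trans _ _ 0%R) ?mulr_ge0 // mulr_le0_ge0 // ltW.
  apply: le_trans (ler_wpM2l A0 (idx_le i)) _.
  by rewrite mulrA ler_wpM2r.
(* Every quotient has rank at least [[H : Gs i]], so each ratio is at least [1 / [G : H]]. *)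
- apply: (@lt_le_trans _ _ (h%:R^-1 : R)%R%:E); first by rewrite lte_fin invr_gt0.
  rewrite limn_esup_lim; apply: lime_ge; first exact: is_cvg_esups.
  apply: nearW => i; apply: le_trans (_ : _ <= ((group_rank (quotient_group (Gs i) (Gs i.+1)))%:R
    / (subgroup_index predT (Gs i))%:R)%R%:E)%E _; last first.
    by apply: ereal_sup_ubound; exists i => /=.
  have [_ _ _ _ rk] := Gnext i; rewrite lee_fin ler_pdivlMr // mulrC ler_pdivrMr //.
  apply: le_trans (idx_le i) _; rewrite mulrC ler_wpM2r // ler_nat //.
Unshelve. all: by end_near.
Qed.

Local Close Scope group_scope.
Local Open Scope ring_scope.

(* The sequence is indexed from 0: Gs i is the (i+1)-st subgroup. *)
Theorem theorem1p1 (R : realType) (G : groupType) (Gfp : finitely_presented G) :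
  (exists H : groupClosed G, has_finite_index H /\
     exists F : groupType, [/\ is_free F, ~ is_abelian F &
       exists f : G -> F,
         {in H &, {morph f : x y / (x * y)%g}} /\ f @` [set` H] = [set: F]])
  <->
  (exists Gs : nat -> groupClosed G,
     (forall i, {subset Gs i.+1 <= Gs i}) /\
     (forall i, has_finite_index (Gs i)) /\
     (forall i, is_normal (Gs 0%N) (Gs i)) /\
     (forall i, is_abelian (quotient_group (Gs i) (Gs i.+1))) /\
     ((fun i => ln (subgroup_index (Gs i) (Gs i.+1))%:R
                / (subgroup_index predT (Gs i))%:R : R) @ \oo --> +oo) /\
     (0 < limn_esup (fun i =>
        ((group_rank (quotient_group (Gs i) (Gs i.+1)))%:R
         / (subgroup_index predT (Gs i))%:R : R)%:E))%E).
Proof.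
split=> [[H [finH onto]]|[Gs [sub [fin [nor [ab [order rank]]]]]]].
  exact: series_of_large Gfp finH onto.
exact: large_of_series Gfp sub fin nor ab order rank.
Qed.
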